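(* Let $s\ge 2$, $t\ge 1$ and $k\ge\max\{2t+1,\,2t(t-1)\}$ be integers. There exists $n_0=n_0(s,k)$ such that for all $n\ge n_0$ the following holds. Let $\mathcal F\subset\binom{[n]}{k}$ be an extremal family (i.e. of maximum possible cardinality) among all subfamilies of $\binom{[n]}{k}$ that do not contain a sunflower with $s$ petals and core of size exactly $t-1$. Then there exists a family $\mathcal T\subset\binom{[n]}{t}$ that does not contain a sunflower with $s$ petals (with any core) such that $|\mathcal T|=\phi(s,t)$ and $$\Big\{F\in\binom{[n]}{k} : F\cap\operatorname{supp}(\mathcal T)\in\mathcal T\Big\}\subset\mathcal F.$$ Moreover, for each $F\in\mathcal F$, either $T\subset F$ for some $T\in\mathcal T$, or $|F\cap\operatorname{supp}(\mathcal T)|\ge t+1$.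
   Context: $[n]=\{1,\dots,n\}$, and $\binom{X}{k}$ is the family of all $k$-element subsets of $X$. A family of $s$ (distinct) sets $\{F_1,\dots,F_s\}$ is a sunflower with $s$ petals if $F_i\cap F_j=\bigcap_{u=1}^s F_u$ for all distinct $i,j\in[s]$; the set $\bigcap_{u=1}^sF_u$ is its core. $\phi(s,t)$ denotes the maximum size of a family of $t$-element sets (on an arbitrary ground set) that does not contain a sunflower with $s$ petals (with arbitrary core). $\operatorname{supp}(\mathcal T)=\bigcup_{T\in\mathcal T}T$. *)

(* Defs.v *)
From mathcomp Require Import all_boot.

Set Implicit Arguments.
Unset Strict Implicit.
Unset Printing Implicit Defensive.

Section Sunflowers.
Variable X : finType.
Implicit Types (A B : {set X}) (F G S : {set {set X}}).

Definition ksubsets (k : nat) : {set {set X}} := [set A : {set X} | #|A| == k].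

Definition core S : {set X} := \bigcap_(A in S) A.

(* Petals are distinct since S is a set.  The notion is meant for s >= 2: for
   s < 2 the pairwise condition is vacuous, and core set0 is the full set. *)
Definition is_sunflower (s : nat) S : Prop :=
  #|S| = s /\ (forall A B, A \in S -> B \in S -> A != B -> A :&: B = core S).

Definition sunflower_free (s : nat) F : Prop :=
  forall S, S \subset F -> ~ is_sunflower s S.

Definition sunflower_core_free (s c : nat) F : Prop :=
  forall S, S \subset F -> is_sunflower s S -> #|core S| <> c.

Definition extremal (P : {set {set X}} -> Prop) F : Prop :=
  P F /\ (forall G, P G -> #|G| <= #|F|).

End Sunflowers.

(* [is_phi s t m] says phi(s, t) = m.  The ground set ranges over all finite
   types: a finite family of finite sets has finite support. *)
Definition is_phi (s t m : nat) : Prop :=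
  (exists (X : finType) (F : {set {set X}}),
      [/\ F \subset ksubsets X t, sunflower_free s F & #|F| = m]) /\
  (forall (X : finType) (F : {set {set X}}),
      F \subset ksubsets X t -> sunflower_free s F -> #|F| <= m).

(* Main.v *)
Require Import Defs.
From mathcomp Require Import all_boot.
From mathcomp Require Import zify ring.

(* Call a set S a kernel of F if some member of F contains S and avoids any given
   set of boundedly many points outside S; kernels with pairwise intersections C
   extend greedily to a sunflower of F with core C.  Write a = k - t.

   By Furedi's intersection semilattice lemma, all but O(n^(a-1)) members A of F
   contain a t-set T such that every set between T and A is a kernel.  For a
   (k-t)-set K, the t-sets T obtained from such members A = K :|: T form a
   sunflower-free family, as a sunflower among them could be enlarged inside K to
   a core of size t - 1.  As F is at least as large as the family of all k-sets
   whose trace on the support of an optimal T-family is in that family, all but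
   O(n^(a-1)) of the sets K carry exactly phi(s,t) sets T.  Two such K meeting in
   t - 1 points carry the same family, which gives one family TT common to all but
   O(n^(a-1)) of the sets K.

   Let M be the set of k-sets whose trace on Y = supp TT is in TT, but that are not
   in F.  A set D of size j < t disjoint from Y is bad if T :|: D is not a kernel
   for some T in TT; each bad D accounts for at least c n^(a-j) members of M.
   Conversely, the members of F that prevent adding all of M to F either meet Y in
   more than t points and contain a bad set, or meet Y in at most t points and
   have, for some j, only bad j-subsets outside Y.  Both kinds number
   O(|M| / n); here k >= 2t(t-1) is needed.  By maximality M is empty. *)

Set Implicit Arguments.
Unset Strict Implicit.
Unset Printing Implicit Defensive.

(** * Kernels and sunflowers *)

Lemma bin_leqX n j : 'C(n, j) <= n ^ j.
Proof.
apply: leq_trans (_ : n ^_ j <= _); first by rewrite -bin_ffact leq_pmulr ?fact_gt0.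
elim: j n => [|j IH] n; first by rewrite ffactn0.
rewrite ffactnS expnS leq_mul2l; apply/orP; right.
by apply: leq_trans (IH _) _; case: j {IH} => // j; rewrite leq_exp2r ?leq_pred.
Qed.

(** Every factor of the falling factorial [m ^_ j] is at least [m - j], hence at least half of
    [n]. *)
Lemma leqX_bin n m j : n <= 2 * (m - j) -> n ^ j <= 2 ^ j * j`! * 'C(m, j).
Proof.
move=> le_nm; have ffact_lb: (m - j) ^ j <= m ^_ j.
  elim: j m {le_nm} => [|j IH] m; first by rewrite ffactn0.
  rewrite ffactnS expnS leq_mul ?leq_subr //.
  by apply: leq_trans (IH _); case: j {IH} => // j; rewrite leq_exp2r //; lia.
rewrite -mulnA [_`! * _]mulnC bin_ffact.
apply: leq_trans (_ : (2 * (m - j)) ^ j <= _); last first.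
  by rewrite expnMn leq_mul2l ffact_lb orbT.
by case: j le_nm {ffact_lb} => // j le_nm; rewrite leq_exp2r.
Qed.

Lemma leq_card_bigcup (I X : finType) (P : {set I}) (g : I -> {set X}) c :
  (forall i, i \in P -> #|g i| <= c) -> #|\bigcup_(i in P) g i| <= #|P| * c.
Proof.
move=> le_c; rewrite -sum_nat_const.
apply: (big_ind2 (fun (A : {set X}) m => #|A| <= m)) => [|A m B p leA leB|i /le_c //].
  by rewrite cards0.
by rewrite cardsU; lia.
Qed.

Lemma subset_of_card (X : finType) (A : {set X}) j :
  j <= #|A| -> exists2 B : {set X}, B \subset A & #|B| = j.
Proof.
move=> le_j; have : 0 < #|[set B : {set X} | B \subset A & #|B| == j]|.
  by rewrite cards_draws bin_gt0.
by case/card_gt0P=> B; rewrite inE => /andP[sBA /eqP]; exists B.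
Qed.

Section Kernels.
Variable X : finType.
Implicit Types (A B C D T : {set X}) (F G S : {set {set X}}).

Lemma ksubsetsP k F : reflect {in F, forall A, #|A| = k} (F \subset ksubsets X k).
Proof.
by apply: (iffP subsetP) => FP A /FP; rewrite inE => /eqP.
Qed.

Lemma card_ksubsets k : #|ksubsets X k| = 'C(#|X|, k).
Proof. exact: card_draws. Qed.

Lemma core_sub S A : A \in S -> core S \subset A.
Proof. exact: bigcap_inf. Qed.

Lemma core_pairwise S C : 1 < #|S| ->
  {in S &, forall A B, A != B -> A :&: B = C} -> core S = C.
Proof.
move=> S_gt1 meetC; have other A : A \in S -> exists2 B, B \in S & A != B.
  move=> SA; have : 0 < #|S :\ A| by rewrite (cardsD1 A) SA in S_gt1.
  by case/card_gt0P=> B; rewrite !inE eq_sym => /andP[]; exists B.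
have /card_gt0P[A SA] : 0 < #|S| by lia.
apply/eqP; rewrite eqEsubset; apply/andP; split.
  by have [B SB neAB] := other A SA; rewrite -(meetC A B) // subsetI !core_sub.
apply/bigcapsP=> D SD; have [B SB neDB] := other D SD.
by rewrite -(meetC D B) // subsetIl.
Qed.

Lemma sunflower_pairwise s S C : 1 < s -> #|S| = s ->
  {in S &, forall A B, A != B -> A :&: B = C} -> is_sunflower s S /\ core S = C.
Proof.
move=> s_gt1 cardS meetC; have coreE : core S = C by apply: core_pairwise; rewrite ?cardS.
by split=> //; split=> // A B SA SB; rewrite coreE; apply: meetC.
Qed.

Lemma sunflower_core_lt s S k : 1 < s -> is_sunflower s S ->
  {in S, forall A, #|A| = k} -> #|core S| < k.
Proof.
move=> s_gt1 [cardS meetS] Sk; have [A SA] : exists A, A \in S.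
  by apply/card_gt0P; rewrite cardS ltnW.
have [B] : exists B, B \in S :\ A.
  by apply/card_gt0P; move: s_gt1; rewrite -cardS (cardsD1 A) SA.
rewrite !inE => /andP[neBA SB]; rewrite -(Sk A SA) proper_card // properEneq core_sub // andbT.
apply: contra neBA => /eqP coreA; rewrite eq_sym eqEcard (Sk A) // (Sk B) // leqnn andbT.
by rewrite -coreA core_sub.
Qed.

(* [S] is the core of sunflowers in [F] that avoid any prescribed set of at
   most [q] points; a member of [F] is such a core of itself. *)
Definition kernel q F A : bool :=
  [forall B : {set X}, (#|B| <= q) ==>
     [exists D in F, (A \subset D) && (D :&: B \subset A)]].

Lemma kernelP q F A :
  reflect (forall B, #|B| <= q ->
             exists2 D, D \in F & A \subset D /\ D :&: B \subset A)
          (kernel q F A).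
Proof.
apply: (iffP forallP) => kerA B.
  by move=> leB; have /implyP/(_ leB)/exists_inP[D FD /andP[]] := kerA B; exists D.
by apply/implyP=> /kerA[D FD [sAD sDA]]; apply/exists_inP; exists D; rewrite ?sAD.
Qed.

Lemma kernel_mem q F A : A \in F -> kernel q F A.
Proof. by move=> FA; apply/kernelP=> B _; exists A; rewrite // subxx subsetIl. Qed.

Lemma kernelS q F G A : F \subset G -> kernel q F A -> kernel q G A.
Proof.
move=> /subsetP sFG /kernelP kerA; apply/kernelP=> B /kerA[D FD sAD].
by exists D; rewrite ?sFG.
Qed.

(** Members of [F] are chosen one index at a time. The one for [i] contains [g i] and, outside
    [g i], avoids both the union [U] of all the [g j] and the union [V] of the members already
    chosen. Each union has at most [s * k] points, which explains the bound on [q]. Since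
    [#|C| < k], the chosen members are distinct. *)
Lemma kernel_sunflower (I : finType) (P : {set I}) (g : I -> {set X}) s k q F C :
    1 < s -> F \subset ksubsets X k -> #|C| < k -> #|P| = s -> 2 * k * s <= q ->
    {in P, forall i, kernel q F (g i)} ->
    {in P &, forall i j, i != j -> g i :&: g j = C} ->
  exists2 S : {set {set X}}, S \subset F & is_sunflower s S /\ core S = C.
Proof.
move=> s_gt1 /ksubsetsP Fk ltCk cardP le_q kerP meetC.
pose U := \bigcup_(i in P) g i.
have leU : #|U| <= s * k.
  rewrite -cardP leq_card_bigcup // => i Pi.
  have /kernelP/(_ set0)[|D FD [sgD _]] := kerP i Pi; first by rewrite cards0.
  by rewrite -(Fk D FD) subset_leq_card.
have sgU i : i \in P -> g i \subset U by move=> Pi; apply: (bigcup_sup i).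
have [f fP] : exists f : I -> {set X}, forall i, i \in P ->
    [/\ f i \in F, g i \subset f i, f i :&: U \subset g i
      & forall j, j \in P -> i != j -> f i :&: f j \subset C].
  suff [f [fF fM]] : exists f : I -> {set X},
      (forall i, i \in enum P -> [/\ f i \in F, g i \subset f i & f i :&: U \subset g i])
      /\ (forall i j, i \in enum P -> j \in enum P -> i != j -> f i :&: f j \subset C).
    exists f => i Pi; have [|? ? ?] := fF i; first by rewrite mem_enum.
    by split=> // j Pj; apply: fM; rewrite mem_enum.
  have: {subset enum P <= P} by move=> i; rewrite mem_enum.
  have : size (enum P) <= s by rewrite -cardE cardP.
  have := enum_uniq P; elim: (enum P) => [|i r IH] /=; first by exists g.
  case/andP=> r'i uniq_r le_r sub_r.
  have Pi : i \in P by apply: sub_r; rewrite mem_head.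
  have [||f [fF fM]] := IH uniq_r; [lia | by move=> j rj; apply: sub_r; rewrite inE rj orbT |].
  pose V := \bigcup_(j in [set j in r]) f j.
  have leV : #|V| <= s * k.
    apply: leq_trans (_ : #|[set j in r]| * k <= _).
      apply: leq_card_bigcup => j; rewrite inE => /fF[Fj _ _].
      by rewrite (Fk _ Fj).
    by rewrite leq_mul2r cardsE (leq_trans (card_size _)) ?orbT //; lia.
  have /kernelP/(_ (U :|: V))[|D FD [sgD sDU]] := kerP i Pi.
    by rewrite cardsU; nia.
  have sDV j : j \in r -> D :&: f j \subset C.
    move=> rj; have neij : i != j by apply: contraNneq r'i => ->.
    have Pj : j \in P by apply: sub_r; rewrite inE rj orbT.
    have [Fj sgj sfj] := fF j rj.
    have sVj : f j \subset V by apply: (bigcup_sup j); rewrite ?inE.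
    rewrite -(meetC i j) //; apply/subsetP=> x /setIP[Dx fx].
    have gx : x \in g i.
      by apply: (subsetP sDU); rewrite !inE Dx (subsetP sVj) ?orbT.
    by rewrite inE gx (subsetP sfj) // inE fx (subsetP (sgU i Pi)).
  exists (fun j => if j == i then D else f j); split=> [j|j j'].
    rewrite inE; case: eqP => [-> _|_ /= /fF //]; split=> //.
    by apply: subset_trans sDU; rewrite setIS ?subsetUl.
  rewrite !inE; case: eqP => [->|_] /=; case: eqP => [->|_] //=; first by rewrite eqxx.
    by move=> _ /sDV.
  by move=> /sDV; rewrite setIC.
  by apply: fM.
have fI : {in P &, forall i j, i != j -> f i :&: f j = C}.
  move=> i j Pi Pj neij; have [_ sgi _ fM] := fP i Pi; have [_ sgj _ _] := fP j Pj.
  by apply/eqP; rewrite eqEsubset fM //= -(meetC i j) // setISS.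
have f_inj : {in P &, injective f}.
  move=> i j Pi Pj eqf; apply/eqP; apply: contraTT isT => neij.
  have [Fi _ _ _] := fP i Pi; have := fI i j Pi Pj neij.
  by rewrite -eqf setIid => eqC; rewrite -eqC (Fk _ Fi) ltnn in ltCk.
exists (f @: P); first by apply/subsetP=> _ /imsetP[i /fP[Fi _ _ _] ->].
apply: sunflower_pairwise; rewrite ?card_in_imset //.
move=> _ _ /imsetP[i Pi ->] /imsetP[j Pj ->] neq.
by apply: fI => //; apply: contraNneq neq => ->.
Qed.

(** The sunflower grows from [s] copies of [A], which meet pairwise in [A]. *)
Lemma kernel_core s k q F A : 1 < s -> F \subset ksubsets X k ->
  2 * k * s <= q -> kernel q F A -> #|A| < k ->
  exists2 S : {set {set X}}, S \subset F & is_sunflower s S /\ core S = A.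
Proof.
move=> s_gt1 Fk le_q kerA ltAk.
apply: (@kernel_sunflower 'I_s [set: 'I_s] (fun=> A) s k q F A) => //.
  by rewrite cardsT card_ord.
by move=> *; rewrite setIid.
Qed.

Definition link F A := [set D in F | A \subset D].

(** A set [B] refuting the kernel property meets every member of the link outside [A], so some point
    of [B :\: A] lies in at least a fraction [1 / q] of these members. *)
Lemma nonkernel_popular q F A : ~~ kernel q F A -> 0 < #|link F A| ->
  exists2 x, x \notin A & #|link F A| <= q * #|link F (x |: A)|.
Proof.
rewrite negb_forall => /existsP[B]; rewrite negb_imply => /andP[leB noD] linkA.
have le_sum : #|link F A| <= \sum_(x in B :\: A) #|link F (x |: A)|.
  apply: leq_trans (_ : #|\bigcup_(x in B :\: A) link F (x |: A)| <= _).
    apply/subset_leq_card/subsetP=> D; rewrite inE => /andP[FD sAD].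
    have := noD; rewrite negb_exists_in => /forall_inP/(_ D FD); rewrite sAD /=.
    case/subsetPn=> x /setIP[Dx Bx] A'x; apply/bigcupP; exists x.
      by rewrite inE A'x.
    by rewrite inE FD subUset sub1set Dx.
  apply: (big_ind2 (fun (E : {set {set X}}) m => #|E| <= m)) => //; first by rewrite cards0.
  by move=> E m E' m' leE leE'; rewrite cardsU; lia.
have [BA0|/set0Pn[x0 Bx0]] := eqVneq (B :\: A) set0.
  by move: le_sum; rewrite BA0 big_set0; lia.
case: (arg_maxnP (fun x => #|link F (x |: A)|) Bx0) => x Bx maxx.
exists x; first by case/setDP: Bx.
apply: leq_trans le_sum _; apply: leq_trans (_ : \sum_(y in B :\: A) #|link F (x |: A)| <= _).
  exact: leq_sum.
rewrite sum_nat_const leq_mul2r (leq_trans _ leB) ?orbT //.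
by rewrite subset_leq_card ?subsetDl.
Qed.

(* Erdos-Rado: a subset A of maximal size with many extensions, in the sense
   q ^ (k - #|A|) < #|link F A|, is a kernel. *)
Lemma sunflower_free_card s k F : 1 < s -> 0 < k -> F \subset ksubsets X k ->
  sunflower_free s F -> #|F| <= (2 * k * s) ^ k.
Proof.
move=> s_gt1 k_gt0 Fk freeF; set q := 2 * k * s; rewrite leqNgt; apply/negP=> gtF.
pose Q A := q ^ (k - #|A|) < #|link F A|.
have Q0 : Q set0.
  rewrite /Q cards0 subn0 (leq_trans gtF) // subset_leq_card //.
  by apply/subsetP=> A FA; rewrite inE FA sub0set.
case: (arg_maxnP (fun A : {set X} => #|A|) Q0) => A QA maxA.
have q_gt0 : 0 < q by rewrite !muln_gt0 k_gt0; lia.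
have linkA : 0 < #|link F A| by apply: leq_trans QA.
have [D /[!inE]/andP[FD sAD]] := card_gt0P linkA.
have le_kA : #|A| <= k by rewrite -(ksubsetsP k F Fk D FD) subset_leq_card.
have ltAk : #|A| < k.
  rewrite ltn_neqAle le_kA andbT; apply/negP=> /eqP cardA.
  have : #|link F A| <= 1; last by move: QA; rewrite /Q cardA subnn expn0; lia.
  apply/card_le1P=> E; rewrite inE => /andP[FE sAE] E'; rewrite !inE.
  have eqA (H : {set X}) : H \in F -> A \subset H -> H = A.
    move=> FH sAH; apply/eqP; rewrite eq_sym eqEcard sAH cardA.
    by rewrite (ksubsetsP k F Fk H FH) leqnn.
  rewrite (eqA E) //; apply/andP/eqP => [[FE' /eqA->]|->] //.
  by rewrite -{1}(eqA E FE sAE) subxx.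
have [kerA|/nonkernel_popular/(_ linkA)[x A'x le_x]] := boolP (kernel q F A).
  have [S sSF [sunS _]] := kernel_core s_gt1 Fk (leqnn _) kerA ltAk.
  exact: freeF sunS.
have : ~~ Q (x |: A).
  by apply/negP=> /maxA; rewrite cardsU1 A'x; lia.
rewrite -leqNgt cardsU1 A'x => le_link.
have : #|link F A| <= q * q ^ (k - (1 + #|A|)).
  by apply: leq_trans le_x _; rewrite leq_mul2l le_link orbT.
rewrite -expnS; have -> : (k - (1 + #|A|)).+1 = k - #|A| by lia.
by rewrite leqNgt; move/negP; apply.
Qed.

End Kernels.

(** * Furedi's intersection semilattice lemma *)


(** The support of [F] is mapped injectively into [Y] by matching positions in the two enumerations;
    the default [y0] is never reached on the support. This allows families on arbitrary ground sets
    to be compared with families on one fixed large set. *)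
Lemma sunflower_free_transfer (X Y : finType) s t (F : {set {set X}}) :
    1 < s -> F \subset ksubsets X t -> sunflower_free s F ->
    0 < #|Y| -> #|cover F| <= #|Y| ->
  exists G : {set {set Y}},
    [/\ G \subset ksubsets Y t, sunflower_free s G & #|G| = #|F|].
Proof.
move=> s_gt1 /ksubsetsP Ft freeF /card_gt0P[y0 _] le_cover.
pose h x := nth y0 (enum Y) (index x (enum (cover F))).
have h_inj : {in cover F &, injective h}.
  move=> x x' Fx Fx' /eqP; rewrite nth_uniq ?enum_uniq //.
  - by move/eqP=> eqi; apply: (index_inj x _ _ eqi); rewrite mem_enum.
  - by rewrite -cardE (leq_trans _ le_cover) // cardE index_mem mem_enum.
  - by rewrite -cardE (leq_trans _ le_cover) // cardE index_mem mem_enum.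
have sF A : A \in F -> A \subset cover F by apply: bigcup_sup.
have hK A : A \in F -> cover F :&: h @^-1: (h @: A) = A.
  move=> FA; apply/setP=> x; rewrite !inE; apply/andP/idP => [[Fx]|Ax].
    by case/imsetP=> a Aa eqh; rewrite (h_inj _ _ Fx _ eqh) // (subsetP (sF A FA)).
  by rewrite (subsetP (sF A FA)) // imset_f.
have hs_inj : {in F &, injective (fun A : {set X} => h @: A)}.
  by move=> A B FA FB /= eqAB; rewrite -(hK A) // eqAB hK.
exists [set h @: A | A : {set X} in F]; split.
- apply/ksubsetsP=> _ /imsetP[A FA ->]; rewrite card_in_imset ?Ft //.
  by move=> x x' Ax Ax'; apply: h_inj; apply: (subsetP (sF A FA)).
- move=> S sSF [cardS meetS]; pose R := [set A in F | h @: A \in S].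
  have sRF : R \subset F by apply/subsetP=> A /[!inE]/andP[].
  apply: (freeF R sRF).
  apply: (@sunflower_pairwise _ _ _ (cover F :&: h @^-1: core S) _ _ _).1 => //.
    rewrite -cardS -(@card_in_imset _ _ (fun A : {set X} => h @: A)); last first.
      by move=> A B /(subsetP sRF) FA /(subsetP sRF) FB; apply: hs_inj.
    apply: eq_card => B; apply/imsetP/idP => [[A /[!inE]/andP[_ SA] ->]|SB] //.
    have /imsetP[A FA defB] := subsetP sSF _ SB.
    by exists A => //; rewrite inE FA -defB.
  move=> A B /[!inE]/andP[FA SA] /andP[FB SB] neAB.
  rewrite -(meetS (h @: A) (h @: B)) //; last by apply: contraNneq neAB => /hs_inj->.
  by rewrite preimsetI -{1}[A]hK // -{1}[B]hK // setIACA setIid.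
- by rewrite card_in_imset.
Qed.

(** * Colour traces of rainbow sets *)

Section Traces.
Variables (X : finType) (k : nat) (chi : X -> 'I_k).
Implicit Types (A B : {set X}) (F G : {set {set X}}) (J : {set 'I_k}).

(** The colouring is a bijection from [A] to the [k] colours, so subsets of different rainbow sets
    can be compared through their colours. *)
Definition rainbow A := (#|A| == k) && (chi @: A == setT).
Definition trace A J := A :&: chi @^-1: J.
(** The case [A = B] is included, so a nonempty family never kills the full colour set. *)
Definition killed J G := forall A B, A \in G -> B \in G -> A :&: B <> trace A J.

Lemma rainbow_inj A : rainbow A -> {in A &, injective chi}.
Proof.
case/andP=> /eqP cardA /eqP chiA; apply/imset_injP.
by rewrite chiA cardsT card_ord cardA.
Qed.

Lemma trace_sub A J : trace A J \subset A. Proof. exact: subsetIl. Qed.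

Lemma card_trace A J : rainbow A -> #|trace A J| = #|J|.
Proof.
move=> rA; have inj : {in trace A J &, injective chi}.
  by move=> x y /setIP[Ax _] /setIP[Ay _]; apply: rainbow_inj rA _ _ Ax Ay.
rewrite -(card_in_imset inj); apply: eq_card => c; apply/imsetP/idP => [[x]|Jc].
  by rewrite !inE => /andP[_ Jx] ->.
have : c \in chi @: A by case/andP: rA => _ /eqP->.
by case/imsetP=> x Ax defc; exists x; rewrite // !inE Ax -defc.
Qed.

Lemma trace_eq A B J : rainbow A -> rainbow B -> trace A J \subset B ->
  trace B J = trace A J.
Proof.
move=> rA rB sAB; apply/eqP; rewrite eq_sym eqEcard !card_trace // leqnn andbT.
by rewrite subsetI sAB subsetIr.
Qed.

Lemma trace_imset A B : rainbow A -> B \subset A -> trace A (chi @: B) = B.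
Proof.
move=> rA sBA; apply/setP=> x; rewrite !inE; apply/andP/idP => [[Ax]|Bx].
  case/imsetP=> y By eqxy.
  by rewrite (rainbow_inj rA Ax _ eqxy) // (subsetP sBA).
by rewrite (subsetP sBA) ?imset_f.
Qed.

Lemma killedS J F G : F \subset G -> killed J G -> killed J F.
Proof. by move=> /subsetP sFG kilG A B /sFG FA /sFG FB; apply: kilG. Qed.

(* The members of [G] containing a fixed nonkernel trace of colour set J are
   removed as a group.  In each group we keep the members containing a popular
   extra element; members of different groups have different J-traces, so J is
   killed in the union of the kept parts. *)
Lemma trace_cleaning q (JJ : {set {set 'I_k}}) G : {in G, forall A, rainbow A} ->
  exists G1 (B : {set 'I_k} -> {set {set X}}),
    [/\ G1 \subset G, forall A J, A \in G1 -> J \in JJ -> kernel q G1 (trace A J),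
        forall J, B J \subset G /\ killed J (B J)
      & #|G| <= #|G1| + q * \sum_(J in JJ) #|B J|].
Proof.
have [n] := ubnP #|G|; elim: n G => // n IH G ltGn rG.
have [/forall_inP kerG|/forall_inPn[A0 GA0]] :=
  boolP [forall A in G, [forall J in JJ, kernel q G (trace A J)]].
  exists G, (fun=> set0); split=> //; last by lia.
  - by move=> A J GA JJ_J; have /forall_inP/(_ J JJ_J) := kerG A GA.
  - by move=> J; rewrite sub0set; split=> // A B; rewrite inE.
case/forall_inPn=> J0 JJ0; set a := trace A0 J0 => nkera.
have link_a : 0 < #|link G a|.
  by apply/card_gt0P; exists A0; rewrite inE GA0 trace_sub.
have [x a'x le_x] := nonkernel_popular nkera link_a.
have sLG : link G a \subset G by apply/subsetP=> A /[!inE]/andP[].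
have sLL : link G (x |: a) \subset link G a.
  by apply/subsetP=> A; rewrite !inE subUset => /and3P[-> _ ->].
have cardG : #|G| = #|link G a| + #|G :\: link G a|.
  by rewrite -(cardsID (link G a) G) (setIidPr sLG).
have [||G1 [B [sG1 kerG1 BP le_G]]] := IH (G :\: link G a).
- by lia.
- by move=> A /setDP[GA _]; apply: rG.
exists G1, (fun J => if J == J0 then B J0 :|: link G (x |: a) else B J); split=> //.
- exact: subset_trans sG1 (subsetDl _ _).
- move=> J; have [sBJ kilBJ] := BP J; case: eqP => [defJ|_]; last first.
    by split=> //; apply: subset_trans sBJ (subsetDl _ _).
  rewrite {}defJ in sBJ kilBJ *; split.
    rewrite subUset (subset_trans sBJ (subsetDl _ _)).
    exact: subset_trans sLL sLG.
  have traceL A : A \in link G a -> trace A J0 = a.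
    by case/setIdP=> GA saA; apply: trace_eq; rewrite ?rG.
  have notB A : A \in B J0 -> ~ a \subset A.
    by move/(subsetP sBJ); rewrite !inE => /andP[+ GA] saA; rewrite GA saA.
  move=> A A' /setUP[BA|LA] /setUP[BA'|LA'].
  + exact: kilBJ.
  + move=> eqA; apply: (notB A BA); rewrite -(traceL A') ?(subsetP sLL) //.
    have [GA _] := setDP (subsetP sBJ _ BA); have [GA' _] := setIdP LA'.
    by rewrite (@trace_eq A A') ?trace_sub ?rG // -eqA subsetIr.
  + rewrite traceL ?(subsetP sLL) // => eqa; apply: (notB A' BA').
    by rewrite -eqa subsetIr.
  + rewrite traceL ?(subsetP sLL) // => eqa; case/negP: a'x; rewrite -eqa.
    move: LA LA'; rewrite !inE !subUset !sub1set.
    by case/and3P=> _ -> _ /and3P[_ -> _].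
- rewrite (bigD1 J0) //= eqxx; rewrite (bigD1 J0) //= in le_G.
  have -> : #|B J0 :|: link G (x |: a)| = #|B J0| + #|link G (x |: a)|.
    rewrite cardsU; suff -> : B J0 :&: link G (x |: a) = set0 by rewrite cards0 subn0.
    apply/setP=> A; rewrite inE [RHS]inE; apply/negP=> /andP[BA LA].
    have [sBJ _] := BP J0; case/setDP: (subsetP sBJ _ BA) => _ /negP; apply.
    exact: subsetP sLL _ LA.
  rewrite (eq_bigr (fun J => #|B J|)) => [|J /andP[_ /negPf->] //].
  rewrite cardG; apply: leq_trans (leq_add le_x le_G) _.
  by rewrite !mulnDr addnCA leq_add2l addnCA addnA.
Qed.

(** Induction on [JJ], the colour sets not yet killed. After cleaning, either [G1] is a fraction
    [1 / c] of [G] and all its traces coloured by [JJ] are kernels, or some [B J] is such a fraction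
    and kills one more colour set [J]. *)
Lemma furedi q (JJ : {set {set 'I_k}}) G : {in G, forall A, rainbow A} ->
    (forall J, J \notin JJ -> killed J G) ->
  exists G1 (J1 : {set {set 'I_k}}),
    [/\ G1 \subset G, forall A J, A \in G1 -> J \in J1 -> kernel q G1 (trace A J),
        forall J, J \notin J1 -> killed J G1
      & #|G| <= (1 + q * #|{set 'I_k}|) ^ #|JJ|.+1 * #|G1|].
Proof.
set c := 1 + _; have [n] := ubnP #|JJ|; elim: n JJ G => // n IH JJ G ltJn rG kilG.
have [G1 [B [sG1 kerG1 BP le_G]]] := trace_cleaning q JJ rG.
have [le1|gt1] := leqP #|G| (c * #|G1|).
  exists G1, JJ; split=> // [J /kilG|]; first exact: killedS.
  by apply: leq_trans le1 _; rewrite leq_mul2r -{1}[c]expn1 leq_pexp2l ?orbT.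
have [/exists_inP[J JJ_J leJ]|] := boolP [exists J in JJ, #|G| <= c * #|B J|].
  have [sBG kilB] := BP J.
  have [|||G2 [J2 [sG2 kerG2 kilG2 le2]]] := IH (JJ :\ J) (B J).
  - by move: ltJn; rewrite (cardsD1 J) JJ_J.
  - by move=> A /(subsetP sBG); apply: rG.
  - move=> J'; rewrite !inE negb_and negbK => /orP[/eqP-> //|/kilG].
    exact: killedS.
  exists G2, J2; split=> //; first exact: subset_trans sG2 sBG.
  apply: leq_trans leJ _; rewrite (cardsD1 J JJ) JJ_J expnS -mulnA leq_mul2l.
  by rewrite le2 orbT.
rewrite negb_exists_in => /forall_inP small.
have le_sum : c * \sum_(J in JJ) #|B J| <= #|{set 'I_k}| * #|G|.
  rewrite big_distrr /=; apply: leq_trans (_ : \sum_(J in JJ) #|G| <= _).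
    by apply: leq_sum => J /small; rewrite -ltnNge => /ltnW.
  by rewrite sum_nat_const leq_mul2r max_card orbT.
(* If all these parts were smaller, the cleaning bound times [c] would give [#|G| <= c * #|G1|], as
   [c] exceeds [q] times the number of colour sets by 1. *)
have : c * #|G| <= c * #|G1| + q * (c * \sum_(J in JJ) #|B J|).
  by rewrite mulnCA -mulnDr leq_mul2l le_G orbT.
have : q * (c * \sum_(J in JJ) #|B J|) <= q * (#|{set 'I_k}| * #|G|).
  by rewrite leq_mul2l le_sum orbT.
by move: gt1; rewrite {3}/c mulnDl mul1n mulnA; lia.
Qed.

End Traces.

(** Colour [A] by its enumeration and all other points freely: each such colouring is rainbow on
    [A]. *)
Lemma card_rainbow_colorings (X : finType) k (A : {set X}) : #|A| = k.+1 ->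
  k.+1 ^ #|X| <= k.+1 ^ k.+1 * #|[set chi : {ffun X -> 'I_k.+1} | rainbow chi A]|.
Proof.
move=> cardA; pose g x : 'I_k.+1 := inord (index x (enum A)).
pose Fm x : pred 'I_k.+1 := if x \in A then pred1 (g x) else predT.
have gK x : x \in A -> g x = index x (enum A) :> nat.
  by move=> Ax; rewrite inordK // -cardA cardE index_mem mem_enum.
have sub : #|family Fm| <= #|[set chi : {ffun X -> 'I_k.+1} | rainbow chi A]|.
  apply/subset_leq_card/subsetP=> chi /familyP chiF; rewrite inE /rainbow cardA eqxx /=.
  have chiE x : x \in A -> chi x = g x.
    by move=> Ax; apply/eqP; have := chiF x; rewrite /Fm Ax.
  rewrite eqEcard subsetT /= cardsT card_ord card_in_imset ?cardA // => x y Ax Ay.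
  rewrite !chiE // => /(congr1 val) /=; rewrite !gK // => eqi.
  by apply: (index_inj x _ _ eqi); rewrite mem_enum.
apply: leq_trans (leq_mul (leqnn _) sub).
have -> : #|family Fm| = k.+1 ^ #|~: A|.
  rewrite card_family.
  have -> : forall e : seq X, foldr muln 1 [seq #|Fm x| | x <- e] =
      k.+1 ^ count (fun x => x \in ~: A) e.
    elim=> //= x e ->; rewrite expnD /Fm inE; case: (x \in A) => /=.
      by rewrite card1.
    by rewrite card_ord expn1.
  by congr (_ ^ _); rewrite cardE [in RHS]/enum_mem size_filter /image_mem enumT.
by rewrite -expnD -cardA cardsC.
Qed.

(** Averaging over all colourings, by counting pairs of a colouring and a set that is rainbow for
    it. *)
Lemma rainbow_subfamily (X : finType) k (G : {set {set X}}) :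
    0 < k -> G \subset ksubsets X k ->
  exists chi : X -> 'I_k, #|G| <= k ^ k * #|[set A in G | rainbow chi A]|.
Proof.
case: k => // k _ /ksubsetsP Gk.
pose R (chi : {ffun X -> 'I_k.+1}) := [set A in G | rainbow chi A].
have sum_le : #|G| * k.+1 ^ #|X| <= k.+1 ^ k.+1 * \sum_chi #|R chi|.
  have -> : \sum_chi #|R chi| =
      \sum_(A in G) #|[set chi : {ffun X -> 'I_k.+1} | rainbow chi A]|.
    under eq_bigr => chi _ do rewrite -sum1_card.
    under [RHS]eq_bigr => A _ do rewrite -sum1_card.
    rewrite (exchange_big_dep (fun A => A \in G)) => [|chi A _ /[!inE]/andP[] //].
    by apply: eq_bigr => A GA; apply: eq_bigl => chi; rewrite !inE GA.
  rewrite -sum_nat_const big_distrr; apply: leq_sum => A GA.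
  by rewrite card_rainbow_colorings ?Gk.
case: (arg_maxnP (fun chi => #|R chi|) (erefl : predT [ffun=> ord0])) => chi _ maxchi.
exists chi; rewrite -(@leq_pmul2r (k.+1 ^ #|X|)) ?expn_gt0 //.
apply: leq_trans sum_le _; rewrite -mulnA leq_mul2l.
apply/orP; right; apply: leq_trans (_ : \sum_(c : {ffun X -> 'I_k.+1}) #|R chi| <= _).
  by apply: leq_sum => c _; apply: maxchi.
by rewrite sum_nat_const card_ffun card_ord mulnC.
Qed.

(** * Union-closed families *)

Lemma union_closed_subsets (Z : finType) (U : {set {set Z}}) (D : {set Z}) :
    set0 \in U -> {in U &, forall A B, A :|: B \in U} ->
    {in D, forall x, [set x] \in U} ->
  forall A : {set Z}, A \subset D -> A \in U.
Proof.
move=> U0 UU UD A sAD.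
have -> : A = \bigcup_(x in A) [set x].
  apply/setP=> y; apply/idP/bigcupP => [Ay|[x Ax]]; first by exists y; rewrite ?inE.
  by rewrite inE => /eqP->.
elim/big_rec: _ => // x B Ax UB; apply: UU => //.
by apply: UD; apply: (subsetP sAD).
Qed.

(* Take a maximal set I0 containing no nonempty member of U.  Each v outside I0
   lies in a member A v inside v |: I0.  If these are not all singletons, their
   unions include one of any size between 2t and the required k - t + 1. *)
Lemma union_closed_structure (Z : finType) t (U : {set {set Z}}) :
    3 * t <= #|Z|.+1 -> t <= #|Z| -> set0 \in U -> {in U &, forall A B, A :|: B \in U} ->
    (forall A : {set Z}, A \in U -> #|A| <> #|Z| - t + 1) ->
    (forall A : {set Z}, #|A| = t.+1 ->
       exists2 B : {set Z}, B \in U & (B != set0) && (B \subset A)) ->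
  exists2 D : {set Z}, #|D| = #|Z| - t & forall A : {set Z}, A \subset D -> A \in U.
Proof.
move=> le_tZ le_t U0 UU Usize Udense.
pose indep (A : {set Z}) := [forall B in U, (B != set0) ==> ~~ (B \subset A)].
have indep0 : indep set0.
  by apply/forall_inP=> B UB; apply/implyP; rewrite subset0.
case: (arg_maxnP (fun A : {set Z} => #|A|) indep0) => I0 indI maxI.
have le_I : #|I0| <= t.
  rewrite leqNgt; apply/negP=> /subset_of_card[A sAI cardA].
  have [B UB /andP[B0 sBA]] := Udense A cardA.
  have /forall_inP/(_ B UB) := indI; rewrite B0 (subset_trans sBA) //.
have [Av AvP] : exists Av : Z -> {set Z}, forall v, v \notin I0 ->
    [/\ Av v \in U, v \in Av v & Av v \subset v |: I0].
  apply: (fin_all_exists (U := fun=> {set Z})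
     (P := fun v B => v \notin I0 -> [/\ B \in U, v \in B & B \subset v |: I0])) => v.
  have [Iv|I'v] := boolP (v \in I0); first by exists set0.
  have : ~~ indep (v |: I0).
    by apply/negP=> /maxI; rewrite cardsU1 I'v; lia.
  rewrite negb_forall_in => /exists_inP[B UB]; rewrite negb_imply negbK => /andP[B0 sB].
  exists B => _; split=> //; apply: contraTT isT => B'v.
  have /forall_inP/(_ B UB) := indI; rewrite B0 /= => /negP[].
  apply/subsetP=> x Bx; have := subsetP sB x Bx; rewrite !inE => /predU1P[eqx|//].
  by rewrite -eqx Bx in B'v.
pose N := \bigcup_(v in ~: I0) (Av v :&: I0).
have sNI : N \subset I0 by apply/bigcupsP=> v _; apply: subsetIr.
have AvE v : v \notin I0 -> Av v = v |: (Av v :&: I0).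
  move=> I'v; have [_ Avv sA] := AvP v I'v.
  apply/setP=> x; rewrite !inE; apply/idP/predU1P => [Ax|[->//|/andP[]//]].
  by have := subsetP sA x Ax; rewrite !inE Ax => /predU1P[->|->]; [left|right].
have cardC : #|~: I0| = #|Z| - #|I0| by rewrite -(cardsC I0) addKn.
have [N0|N0] := eqVneq N set0.
  have [|D sDI cardD] := @subset_of_card Z (~: I0) (#|Z| - t); first by rewrite cardC; lia.
  exists D => //; apply: union_closed_subsets => // v /(subsetP sDI); rewrite inE => I'v.
  have [UA _ _] := AvP v I'v; rewrite AvE // in UA.
  suff -> : [set v] = v |: (Av v :&: I0) by [].
  suff -> : Av v :&: I0 = set0 by rewrite setU0.
  by apply/eqP; rewrite -subset0 -N0; apply: (bigcup_sup v); rewrite ?inE.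
have N_gt0 : 0 < #|N| by rewrite card_gt0.
have le_N : #|N| <= #|I0| by apply: subset_leq_card.
have [w wP] : exists w : Z -> Z, forall a, a \in N -> w a \in ~: I0 /\ a \in Av (w a).
  apply: (fin_all_exists (U := fun=> Z)
    (P := fun a v => a \in N -> v \in ~: I0 /\ a \in Av v)) => a.
  have [/bigcupP[v I'v /setIP[Aa _]]|] := boolP (a \in N); last by exists a.
  by exists v.
(* The sets [Av v] with [v] in [V0] already cover [N]. The set [E] pads [V0] so that [V :|: N] has
   exactly the forbidden size; there is room for this because [#|V0| + #|N| <= 2 * t]. *)
pose V0 := w @: N.
have sV0 : V0 \subset ~: I0 by apply/subsetP=> _ /imsetP[a /wP[]] ? _ ->.
have le_V0 : #|V0| <= #|N| by apply: leq_imset_card.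
have [|E sE cardE] := @subset_of_card Z (~: I0 :\: V0) (#|Z| - t + 1 - #|N| - #|V0|).
  rewrite cardsD (setIidPr sV0) cardC; lia.
have disj : [disjoint V0 & E].
  rewrite disjoint_sym; apply: disjointWl sE _.
  by rewrite -setI_eq0 setDE -setIA [~: V0 :&: _]setIC setICr setI0.
pose V := V0 :|: E.
have sV : V \subset ~: I0 by rewrite subUset sV0 (subset_trans sE) ?subsetDl.
have cardV : #|V| = #|Z| - t + 1 - #|N|.
  by rewrite cardsU disjoint_setI0 // cards0 cardE; lia.
case: (Usize (\bigcup_(v in V) Av v)).
  elim/big_rec: _ => // v B Vv UB; apply: UU => //.
  by have := subsetP sV v Vv; rewrite inE => /AvP[].
have -> : \bigcup_(v in V) Av v = V :|: N.
  apply/eqP; rewrite eqEsubset; apply/andP; split.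
    apply/bigcupsP=> v Vv; have := subsetP sV v Vv; rewrite inE => I'v.
    rewrite AvE // subUset sub1set inE Vv /=.
    by apply: subset_trans (subsetUr _ _); apply: (bigcup_sup v); rewrite ?inE.
  apply/subsetP=> x /setUP[Vx|Nx].
    apply/bigcupP; exists x => //; have := subsetP sV x Vx.
    by rewrite inE => /AvP[].
  have [_ Ax] := wP x Nx; apply/bigcupP; exists (w x) => //.
  by rewrite inE imset_f.
rewrite cardsU; have -> : V :&: N = set0.
  apply/eqP; rewrite -subset0; apply/subsetP=> x /setIP[Vx Nx].
  by have := subsetP sV x Vx; rewrite inE (subsetP sNI).
by rewrite cards0 cardV; lia.
Qed.

(** * Members with many kernels *)

Section Good.
Variable X : finType.
Implicit Types (A B C D K S T : {set X}) (F G : {set {set X}}).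

Definition good q t F A T :=
  [&& #|T| == t, T \subset A &
      [forall S : {set X}, (T \subset S) && (S \subset A) ==> kernel q F S]].

Lemma goodP q t F A T :
  reflect [/\ #|T| = t, T \subset A &
             forall S, T \subset S -> S \subset A -> kernel q F S]
          (good q t F A T).
Proof.
apply: (iffP and3P) => [[/eqP cardT sTA /forallP kerS]|[cardT sTA kerS]].
  by split=> // S sTS sSA; have := kerS S; rewrite sTS sSA.
split=> //; first exact/eqP.
by apply/forallP=> S; apply/implyP=> /andP[]; apply: kerS.
Qed.

(** The factor [k ^ k] pays for passing to a rainbow subfamily, the other one for Furedi's lemma
    started with all colour sets. *)
Definition furedi_const q k :=
  k ^ k * (1 + q * #|{set 'I_k}|) ^ #|{set 'I_k}|.+1.

(** If the bad members were too many, Furedi's lemma would leave more than ['C(#|X|, k - t - 1)] of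
    them, with kernel colour sets [J1]. The complements of the sets in [J1] form a union-closed
    family, whose structure yields [t] colours with all supersets in [J1]. The trace on these
    colours makes a bad member good. *)
Lemma card_bad s k t q F :
    1 < s -> 0 < t -> 2 * t < k -> 3 * t <= k.+1 -> 2 * k * s <= q ->
    F \subset ksubsets X k -> sunflower_core_free s (t - 1) F ->
  #|[set A in F | [forall T, ~~ good q t F A T]]|
    <= furedi_const q k * #|X| ^ (k - t - 1).
Proof.
move=> s_gt1 t_gt0 lt_tk le3t le_q Fk freeF; set G := [set A in F | _].
have sGF : G \subset F by apply/subsetP=> A /[!inE]/andP[].
have lt_t1 : t - 1 < k by lia.
have le_kq : k + k <= q.
  by rewrite addnn -mul2n (leq_trans _ le_q) // leq_pmulr //; lia.
have [chi le_G] : exists chi : X -> 'I_k, #|G| <= k ^ k * #|[set A in G | rainbow chi A]|.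
  by apply: rainbow_subfamily; [lia | apply: subset_trans Fk].
set R := [set A in G | _] in le_G.
have rR : {in R, forall A, rainbow chi A} by move=> A /[!inE]/andP[].
have [|G1 [J1 [sG1 kerG1 kilG1 le_R]]] := @furedi X k chi q [set: {set 'I_k}] R rR.
  by move=> J; rewrite inE.
have sG1F : G1 \subset F.
  by apply: subset_trans sGF; apply: subset_trans sG1 _; apply/subsetP=> A /[!inE]/andP[].
suff le_G1 : #|G1| <= 'C(#|X|, k - t - 1).
  apply: leq_trans le_G _; rewrite /furedi_const -mulnA leq_mul2l; apply/orP; right.
  rewrite cardsT in le_R; apply: leq_trans le_R _; rewrite leq_mul2l.
  by rewrite (leq_trans le_G1) ?bin_leqX ?orbT.
rewrite leqNgt; apply/negP=> ltG1.
have rG1 A : A \in G1 -> rainbow chi A by move=> /(subsetP sG1)/rR.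
have kG1 A : A \in G1 -> #|A| = k by move=> /(subsetP sG1F)/(ksubsetsP k F Fk).
have [A0 GA0] : exists A, A \in G1 by apply/card_gt0P; apply: leq_trans ltG1.
have traceT A : trace chi A setT = A by rewrite /trace preimsetT setIT.
have J1T : [set: 'I_k] \in J1.
  apply: contraT => /kilG1/(_ A0 A0 GA0 GA0) []; by rewrite setIid traceT.
(* Extend the [J]-trace of [A0] to a member [A] avoiding the rest of [A0], then the [J']-trace to a
   member [A'] avoiding the rest of [A0 :|: A]. They meet exactly in the trace of [J :&: J'], which
   is therefore not killed. *)
have J1I : {in J1 &, forall J J', J :&: J' \in J1}.
  move=> J J' JJ JJ'; apply: contraT => /kilG1 kil.
  have /kernelP/(_ A0)[|A GA [sJA sAJ]] := kerG1 A0 J GA0 JJ.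
    by rewrite kG1 // (leq_trans (leq_addr k k)).
  have /kernelP/(_ (A0 :|: A))[|A' GA' [sJA' sAJ']] := kerG1 A0 J' GA0 JJ'.
    by rewrite cardsU (kG1 A0) // (kG1 A) //; apply: leq_trans (leq_subr _ _) le_kq.
  have traceI : trace chi A0 J :&: trace chi A0 J' = trace chi A0 (J :&: J').
    by rewrite /trace preimsetI setIACA setIid.
  case: (kil A A' GA GA').
  rewrite (@trace_eq _ _ _ A0) ?rG1 //; last first.
    by rewrite -traceI; apply: subset_trans sJA; apply: subsetIl.
  rewrite -traceI; apply/eqP; rewrite eqEsubset; apply/andP; split; last exact: setISS.
  have sAA' : A :&: A' \subset trace chi A0 J'.
    by rewrite setIC; apply: subset_trans sAJ'; rewrite setIS ?subsetUr.
  rewrite subsetI sAA' andbT; apply: subset_trans sAJ.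
  rewrite subsetI subsetIl /=; apply: subset_trans sAA' _; exact: trace_sub.
have J1size J : J \in J1 -> #|J| <> t - 1.
  move=> JJ cardJ; have kerJ := kernelS sG1F (kerG1 A0 J GA0 JJ).
  have cardA0J : #|trace chi A0 J| = t - 1 by rewrite card_trace ?rG1.
  have [|S sSF [sunS coreS]] := kernel_core s_gt1 Fk le_q kerJ; first by rewrite cardA0J.
  by apply: (freeF S sSF sunS); rewrite coreS.
(* By pigeonhole two distinct members of [G1] share their [P]-trace; the colours of their
   intersection form the required proper superset of [P]. *)
have J1dense (P : {set 'I_k}) : #|P| = k - t - 1 ->
    exists2 J, J \in J1 & (P \subset J) && (J != setT).
  move=> cardP.
  have [/exists_inP[A GA /exists_inP[A' GA' /andP[neAA' /eqP eqT]]]|noA] :=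
    boolP [exists A in G1, [exists A' in G1, (A != A') && (trace chi A P == trace chi A' P)]].
    have defI : A :&: A' = trace chi A (chi @: (A :&: A')).
      by rewrite trace_imset ?rG1 ?subsetIl.
    exists (chi @: (A :&: A')).
      by apply: contraT => /kilG1/(_ A A' GA GA') [].
    apply/andP; split.
      apply/subsetP=> c Pc; have : c \in chi @: A by case/andP: (rG1 A GA) => _ /eqP->.
      case/imsetP=> x Ax defc; rewrite defc imset_f // inE Ax.
      have : x \in trace chi A P by rewrite !inE Ax -defc.
      by rewrite eqT; apply/subsetP/trace_sub.
    apply: contra neAA' => /eqP chiT; move: defI; rewrite chiT traceT => /setIidPl sAA'.
    by rewrite eqEcard sAA' !kG1 /=.
  suff: #|G1| <= 'C(#|X|, k - t - 1) by rewrite leqNgt ltG1.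
  rewrite -card_ksubsets -(@card_in_imset _ _ (fun A => trace chi A P)).
    apply/subset_leq_card/subsetP=> _ /imsetP[A GA ->].
    by rewrite inE card_trace ?rG1 ?cardP.
  move=> A A' GA GA' /= eqT; apply: contraNeq noA => neAA'.
  by apply/exists_inP; exists A => //; apply/exists_inP; exists A'; rewrite // neAA' eqT eqxx.
have [||||||D cardD DU] := @union_closed_structure 'I_k t [set W | ~: W \in J1].
- by rewrite card_ord.
- by rewrite card_ord; lia.
- by rewrite inE setC0.
- by move=> W W'; rewrite !inE setCU; apply: J1I.
- move=> W; rewrite inE card_ord => /J1size; rewrite cardsCs setCK card_ord => neW eqW.
  by apply: neW; rewrite eqW; lia.
- move=> W cardW; have [|J JJ /andP[sWJ neJ]] := J1dense (~: W).
    by rewrite cardsCs setCK card_ord cardW; lia.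
  exists (~: J); rewrite ?inE ?setCK // -{1}[W]setCK setCS sWJ andbT.
  by rewrite -setCT (inj_eq (@setC_inj _)).
have /setIdP[/setIdP[_ /forallP notgood] _] := subsetP sG1 A0 GA0.
have /negP := notgood (trace chi A0 (~: D)); apply; apply/goodP; split.
- rewrite card_trace ?rG1 // cardsCs setCK cardD card_ord; lia.
- exact: trace_sub.
move=> S sTS sSA; rewrite -(trace_imset (rG1 A0 GA0) sSA).
apply: (kernelS sG1F); apply: kerG1 => //.
have := DU (~: (chi @: S)); rewrite inE setCK; apply.
rewrite -[D]setCK setCS; apply/subsetP=> c Dc.
have : c \in chi @: A0 by case/andP: (rG1 A0 GA0) => _ /eqP->.
case/imsetP=> x Ax defc; rewrite defc imset_f // (subsetP sTS) //.
by rewrite inE Ax inE -defc.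
Qed.

End Good.

(** * The common frame *)

Section Counting.
Variable X : finType.
Implicit Types (A B D K : {set X}).

Lemma card_supersets j B :
  #|[set A in ksubsets X j | B \subset A]| <= #|X| ^ (j - #|B|).
Proof.
apply: leq_trans (bin_leqX _ _); rewrite -card_ksubsets.
rewrite -(@card_in_imset _ _ (fun A => A :\: B)) => [|A A']; last first.
  move=> /[!inE] /andP[_ sBA] /andP[_ sBA'] /= eqD.
  by rewrite -(setID A B) -(setID A' B) eqD (setIidPr sBA) (setIidPr sBA').
apply/subset_leq_card/subsetP=> _ /imsetP[A /[!inE]/andP[/eqP <- sBA] ->].
by rewrite cardsD (setIidPr sBA).
Qed.

Lemma card_meeting j B :
  #|[set A in ksubsets X j | ~~ [disjoint A & B]]| <= #|B| * #|X| ^ (j - 1).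
Proof.
apply: leq_trans (_ : #|\bigcup_(x in B) [set A in ksubsets X j | [set x] \subset A]| <= _).
  apply/subset_leq_card/subsetP=> A /setIdP[Aj]; rewrite -setI_eq0 => /set0Pn[x /setIP[Ax Bx]].
  by apply/bigcupP; exists x; rewrite // inE Aj sub1set.
by apply: leq_card_bigcup => x _; rewrite (leq_trans (card_supersets _ _)) ?cards1.
Qed.

Lemma bin_leq_avoid j B : 'C(#|X|, j) <= 'C(#|X| - #|B|, j) + #|B| * #|X| ^ (j - 1).
Proof.
rewrite -card_ksubsets -(cardsID [set A : {set X} | ~~ [disjoint A & B]]) addnC.
apply: leq_add; last by rewrite -setIdE card_meeting.
have <- : #|~: B| = #|X| - #|B| by rewrite cardsCs setCK.
rewrite -cards_draws; apply/subset_leq_card/subsetP=> A.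
by rewrite !inE negbK disjoints_subset andbC.
Qed.

End Counting.

Section Frame.
Variable X : finType.
Implicit Types (A B C D K : {set X}) (F G : {set {set X}}).

Definition frame k (TT : {set {set X}}) := [set A in ksubsets X k | A :&: cover TT \in TT].

(** The traces on the support of [TT] would form a sunflower in [TT]. They are distinct, since equal
    traces would put [t] points into a core of size [t - 1]. *)
Lemma frame_core_free s t k (TT : {set {set X}}) : 1 < s -> 0 < t ->
    TT \subset ksubsets X t -> sunflower_free s TT ->
  sunflower_core_free s (t - 1) (frame k TT).
Proof.
move=> s_gt1 t_gt0 /ksubsetsP TTt freeT S /subsetP sSF [cardS meetS] coreS.
have TS A : A \in S -> A :&: cover TT \in TT by move=> /sSF /setIdP[].
have inj : {in S &, injective (fun A : {set X} => A :&: cover TT)}.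
  move=> A B SA SB /= eqY; apply: contraTeq isT => neAB.
  have : #|A :&: cover TT| <= #|core S|.
    by rewrite subset_leq_card // -(meetS A B) // subsetI subsetIl eqY subsetIl.
  by rewrite TTt ?TS // coreS; lia.
apply: (freeT [set A :&: cover TT | A : {set X} in S]).
  by apply/subsetP=> _ /imsetP[A /TS TA ->].
apply: (@sunflower_pairwise _ _ _ (core S :&: cover TT) _ _ _).1 => //.
  by rewrite card_in_imset.
move=> _ _ /imsetP[A SA ->] /imsetP[B SB ->] neq.
by rewrite setIACA setIid (meetS A B) //; apply: contraNneq neq => ->.
Qed.

(** A member of [TT] joined to any [(k - t)]-set outside the support lies in the frame, and both
    parts can be recovered. *)
Lemma card_frame t k (TT : {set {set X}}) : t <= k -> TT \subset ksubsets X t ->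
  #|TT| * 'C(#|X| - #|cover TT|, k - t) <= #|frame k TT|.
Proof.
move=> le_tk /ksubsetsP TTt; set Y := cover TT.
have <- : #|~: Y| = #|X| - #|Y| by rewrite cardsCs setCK.
rewrite -cards_draws -cardsX.
have sY (T : {set X}) : T \in TT -> T \subset Y by apply: bigcup_sup.
have meetY (T K : {set X}) : T \in TT -> K \subset ~: Y -> (T :|: K) :&: Y = T.
  move=> TT_T; rewrite -disjoints_subset -setI_eq0 => /eqP KY.
  by rewrite setIUl KY setU0; apply/setIidPl/sY.
have diffY (T K : {set X}) : T \in TT -> K \subset ~: Y -> (T :|: K) :\: Y = K.
  move=> TT_T; rewrite -disjoints_subset => dKY.
  have /eqP T0 : T :\: Y == set0 by rewrite setD_eq0 sY.
  by rewrite setDUl T0 set0U; apply/setDidPl.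
rewrite -(@card_in_imset _ _ (fun p => p.1 :|: p.2)).
  apply/subset_leq_card/subsetP=> _ /imsetP[[T K] /setXP[TT_T]] /setIdP[/= sK /eqP cardK] ->.
  rewrite inE meetY // TT_T andbT inE cardsU (TTt _ TT_T) cardK.
  suff -> : T :&: K = set0 by rewrite cards0 subn0 subnKC.
  apply/eqP; rewrite setI_eq0 disjoint_sym.
  apply: disjointWr (sY T TT_T) _; by rewrite disjoints_subset.
move=> [T K] [T' K'] /setXP[TT_T /setIdP[/= sK _]] /setXP[TT_T' /setIdP[/= sK' _]] eqU.
congr pair; first by rewrite -(meetY T K) // eqU meetY.
by rewrite -(diffY T K) // eqU diffY.
Qed.

Lemma leq_card_cover_ksubsets t (TT : {set {set X}}) : TT \subset ksubsets X t ->
  #|cover TT| <= #|TT| * t.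
Proof. by move=> /ksubsetsP TTt; apply: leq_card_bigcup => A /TTt->. Qed.

End Frame.

(** * Petal families of [(k - t)]-sets *)

Section CommonFrame.
Variables (X : finType) (s t k q phi : nat) (F : {set {set X}}).
Implicit Types (A B C D K T : {set X}).
Hypotheses (s_gt1 : 1 < s) (t_gt0 : 0 < t) (lt_tk : 2 * t < k) (le_3tk : 3 * t <= k.+1).
Hypothesis le_q : 2 * k * s <= q.
Hypotheses (Fk : F \subset ksubsets X k) (freeF : sunflower_core_free s (t - 1) F).
Hypothesis maxF : forall G : {set {set X}}, G \subset ksubsets X k ->
  sunflower_core_free s (t - 1) G -> #|G| <= #|F|.
Hypothesis le_phi : forall TT : {set {set X}}, TT \subset ksubsets X t ->
  sunflower_free s TT -> #|TT| <= phi.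
Hypothesis phi_attained : exists TT : {set {set X}},
  [/\ TT \subset ksubsets X t, sunflower_free s TT & #|TT| = phi].

Definition petals K :=
  [set T : {set X} | [disjoint T & K] && ((T :|: K \in F) && good q t F (T :|: K) T)].

Lemma petals_card K T : T \in petals K -> #|T| = t.
Proof. by case/setIdP=> _ /and3P[_ /eqP]. Qed.

Lemma petals_ksubsets K : petals K \subset ksubsets X t.
Proof. by apply/ksubsetsP=> T /petals_card. Qed.

(** A sunflower among these petals is enlarged by points [E] of [K :&: K'] until its core has size
    [t - 1]. Each [T :|: E] lies between [T] and the member giving rise to [T], so it is a kernel.
    Two sets [K] and [K'] are treated together in order to compare their petals. *)
Lemma petals_free K K' : t - 1 <= #|K :&: K'| -> sunflower_free s (petals K :|: petals K').
Proof.
move=> le_KK' S sS sunS; have [cardS meetS] := sunS.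
have St (T : {set X}) : T \in S -> #|T| = t.
  by move=> /(subsetP sS)/setUP[]; apply: petals_card.
have lt_core : #|core S| < t := sunflower_core_lt s_gt1 sunS St.
have [|E sE cardE] := @subset_of_card X (K :&: K') (t - 1 - #|core S|); first by lia.
move: sE; rewrite subsetI => /andP[sEK sEK'].
have disjE (T : {set X}) : T \in S -> T :&: E = set0.
  move=> /(subsetP sS) /setUP[] /setIdP[dT _]; apply/eqP; rewrite setI_eq0.
    exact: disjointWr sEK dT.
  exact: disjointWr sEK' dT.
have [T0 ST0] : exists T : {set X}, T \in S by apply/card_gt0P; rewrite cardS ltnW.
have cardC : #|core S :|: E| = t - 1.
  rewrite cardsU cardE.
  suff -> : core S :&: E = set0 by rewrite cards0; lia.
  by apply/eqP; rewrite -subset0 -(disjE T0 ST0) setSI ?core_sub.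
have [|||R sRF [sunR coreR]] :=
    @kernel_sunflower X _ S (fun T => T :|: E) s k q F (core S :|: E) s_gt1 Fk _ cardS le_q.
- by rewrite cardC; lia.
- move=> T /(subsetP sS) /setUP[] /setIdP[_ /andP[_ /goodP[_ _ kerT]]].
    by apply: kerT; rewrite ?subsetUl ?setUS.
  by apply: kerT; rewrite ?subsetUl ?setUS.
- by move=> T T' ST ST' neT; rewrite -setUIl meetS.
by apply: (freeF sRF sunR); rewrite coreR.
Qed.

Lemma petals_eq K K' : t - 1 <= #|K :&: K'| -> #|petals K| = phi ->
  #|petals K'| = phi -> petals K = petals K'.
Proof.
move=> /petals_free freeU cardK cardK'.
have := le_phi _ freeU; rewrite subUset !petals_ksubsets => /(_ isT) leU.
have subU (A B : {set {set X}}) : #|A| = phi -> #|A :|: B| <= phi -> B \subset A.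
  move=> cardA leAB; suff -> : A = A :|: B by apply: subsetUr.
  by apply/eqP; rewrite eqEcard subsetUl cardA.
apply/eqP; rewrite eqEsubset subU //=; first by apply: subU.
by rewrite setUC.
Qed.

Lemma leq_petals K : #|K| = k - t -> #|petals K| <= phi.
Proof.
move=> cardK; apply: le_phi; first exact: petals_ksubsets.
by rewrite -[petals K]setUid; apply: petals_free; rewrite setIid cardK; lia.
Qed.

Definition full := [set K in ksubsets X (k - t) | #|petals K| == phi].
Definition nonfull := [set K in ksubsets X (k - t) | #|petals K| != phi].

(** The first term bounds the loss from [(k - t)]-sets that meet the support of an optimal family,
    which has at most [phi * t] points; the second counts the members without a good [t]-set. *)
Definition nonfull_const := phi * (phi * t) + furedi_const q k.

Lemma card_full : #|full| + #|nonfull| = 'C(#|X|, k - t).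
Proof.
rewrite -card_ksubsets -(cardsID [set K : {set X} | #|petals K| == phi] (ksubsets X (k - t))).
by congr (_ + _); apply: eq_card => K; rewrite !inE // andbC.
Qed.

(** Each good member is counted by a petal of some [K], and each nonfull [K] has at least one petal
    fewer than [phi]. Maximality makes [F] at least as large as an optimal frame, so few such
    deficits are possible. *)
Lemma card_nonfull : #|nonfull| <= nonfull_const * #|X| ^ (k - t - 1).
Proof.
pose bad := [set A in F | [forall T, ~~ good q t F A T]].
have le_bad : #|bad| <= furedi_const q k * #|X| ^ (k - t - 1) by apply: (card_bad s_gt1).
have [TT [TTt freeT cardT]] := phi_attained.
have le_F : phi * 'C(#|X| - #|cover TT|, k - t) <= #|F|.
  rewrite -cardT; apply: leq_trans (card_frame _ TTt) _; first by lia.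
  by apply: maxF; [rewrite /frame setIdE subsetIl | apply: frame_core_free].
have le_goods : #|F :\: bad| <= \sum_(K in ksubsets X (k - t)) #|petals K|.
  apply: leq_trans (_ : #|\bigcup_(K in ksubsets X (k - t)) [set T :|: K | T in petals K]| <= _).
    apply/subset_leq_card/subsetP=> A /setDP[FA]; rewrite inE FA /= => /forallPn[T].
    rewrite negbK => gT; have /goodP[cardTt sTA _] := gT.
    have TA : T :|: (A :\: T) = A by have := setID A T; rewrite (setIidPr sTA).
    apply/bigcupP; exists (A :\: T).
      by rewrite inE cardsD (setIidPr sTA) cardTt (ksubsetsP _ _ Fk).
    apply/imsetP; exists T => //; rewrite inE TA FA gT /= andbT.
    by rewrite disjoint_sym disjoints_subset setDE subsetIr.
  apply: leq_trans (_ : \sum_(K in ksubsets X (k - t)) #|[set T :|: K | T in petals K]| <= _).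
    apply: (big_ind2 (fun (E : {set {set X}}) m => #|E| <= m)) => //; first by rewrite cards0.
    by move=> E m E' m' leE leE'; rewrite cardsU; lia.
  by apply: leq_sum => K _; apply: leq_imset_card.
have le_sum : \sum_(K in ksubsets X (k - t)) #|petals K| + #|nonfull|
    <= phi * 'C(#|X|, k - t).
  have -> : #|nonfull| = \sum_(K in ksubsets X (k - t)) (#|petals K| != phi).
    rewrite -sum1_card big_mkcond [RHS]big_mkcond; apply: eq_bigr => K _.
    by rewrite !inE; case: (_ == _) => //=; case: (_ == _).
  rewrite -big_split -card_ksubsets mulnC -sum_nat_const; apply: leq_sum => K /=.
  rewrite inE => /eqP cardK; have := leq_petals cardK; case: eqP => /= [->|]; lia.
have le_bin := bin_leq_avoid (k - t) (cover TT).
have le_cov := leq_card_cover_ksubsets TTt; rewrite cardT in le_cov.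
have cardF : #|F| = #|bad| + #|F :\: bad|.
  by rewrite -(cardsID bad F) (setIidPr _) // /bad setIdE subsetIl.
have le_1 : phi * 'C(#|X|, k - t) <=
    phi * 'C(#|X| - #|cover TT|, k - t) + phi * (phi * t) * #|X| ^ (k - t - 1).
  rewrite -mulnA -mulnDr leq_mul2l; apply/orP; right.
  by apply: leq_trans le_bin _; rewrite leq_add2l leq_mul2r le_cov orbT.
rewrite /nonfull_const mulnDl.
move: (phi * 'C(_, _)) (phi * 'C(_, _)) (phi * (phi * t) * _) (furedi_const q k * _)
  le_bad le_F le_sum le_goods le_1 cardF.
move: (\sum_(K in _) _) #|bad| #|F| #|F :\: bad| #|nonfull| => *; lia.
Qed.

(* For disjoint full K and K', the set of t - 1 elements of K and all but t - 1
   elements of K' meets both in at least t - 1 elements, so it is not full when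
   K and K' have different petals. *)
Lemma card_different_pairs :
  #|[set p in setX full full | [disjoint p.1 & p.2] && (petals p.1 != petals p.2)]|
    <= #|nonfull| * 2 ^ (k - t) * #|X| ^ (k - t).
Proof.
have [pt ptP] : exists pt : {set X} -> {set X}, forall K, #|K| = k - t ->
    pt K \subset K /\ #|pt K| = t - 1.
  apply: (fin_all_exists (U := fun=> {set X})
    (P := fun K P => #|K| = k - t -> P \subset K /\ #|P| = t - 1)) => K.
  have [cardK|neK] := eqVneq #|K| (k - t); last by exists set0 => /eqP; rewrite (negPf neK).
  by have [|P sPK cardP] := @subset_of_card X K (t - 1); [lia | exists P].
pose mix (p : {set X} * {set X}) := pt p.1 :|: (p.2 :\: pt p.2).
set Pairs := [set p in _ | _].
(* The nonfull set [mix p] and its subset [pt p.1] have at most [#|nonfull| * 2 ^ (k - t)] values.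
   The two remaining blocks, of sizes adding up to [k - t], give the power of [#|X|], and the four
   pieces determine the pair. *)
pose code (p : {set X} * {set X}) := ((mix p, pt p.1), (p.1 :\: pt p.1, pt p.2)).
have pairsP K K' : (K, K') \in Pairs ->
    [/\ #|K| = k - t /\ #|petals K| = phi, #|K'| = k - t /\ #|petals K'| = phi,
        K :&: K' = set0 & petals K != petals K'].
  rewrite !inE /= => /andP[/andP[/andP[/eqP ? /eqP ?] /andP[/eqP ? /eqP ?]] /andP[dK neK]].
  by split=> //; apply/eqP; rewrite setI_eq0.
pose MP := \bigcup_(M in nonfull) [set (M, P) | P in powerset M].
have le_MP : #|MP| <= #|nonfull| * 2 ^ (k - t).
  apply: leq_card_bigcup => M /[!inE]/andP[/eqP <- _].
  by rewrite -card_powerset leq_imset_card.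
have cardD K : #|K| = k - t -> #|K :\: pt K| = k - t - (t - 1).
  by move=> cardK; have [sP cardP] := ptP K cardK; rewrite cardsD (setIidPr sP) cardK cardP.
have code_sub : code @: Pairs \subset
    setX MP (setX (ksubsets X (k - t - (t - 1))) (ksubsets X (t - 1))).
  apply/subsetP=> _ /imsetP[[K K'] /pairsP[[cardK fullK] [cardK' fullK'] dK neK] ->].
  have [sP cardP] := ptP K cardK; have [sP' cardP'] := ptP K' cardK'.
  rewrite inE /= in_setX !inE /= cardD // eqxx cardP' eqxx !andbT.
  have cardM : #|mix (K, K')| = k - t.
    rewrite cardsU /= cardP cardD //.
    have -> : pt K :&: (K' :\: pt K') = set0.
      by apply/eqP; rewrite -subset0 -dK setISS ?subsetDl.
    by rewrite cards0; lia.
  apply/bigcupP; exists (mix (K, K')); last by rewrite imset_f // inE subsetUl.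
  rewrite inE inE cardM eqxx /=; apply: contra neK => /eqP fullM; apply/eqP.
  transitivity (petals (mix (K, K'))); apply: petals_eq => //.
    by rewrite -cardP subset_leq_card // subsetI sP subsetUl.
  apply: leq_trans (_ : #|K' :\: pt K'| <= _); first by rewrite cardD //; lia.
  by rewrite subset_leq_card // subsetI subsetUr subsetDl.
have code_inj : {in Pairs &, injective code}.
  have decode K K' : (K, K') \in Pairs ->
      K = pt K :|: (K :\: pt K) /\ K' = pt K' :|: (mix (K, K') :\: pt K).
    case/pairsP=> [[cardK _] [cardK' _] dK _].
    have [sP _] := ptP K cardK; have [sP' _] := ptP K' cardK'.
    split; first by have := setID K (pt K); rewrite (setIidPr sP).
    have /eqP d0 : pt K :\: pt K == set0 by rewrite setD_eq0.
    rewrite /mix /= setDUl d0 set0U -{1}(setID K' (pt K')) (setIidPr sP').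
    congr (_ :|: _); apply/esym/setDidPl.
    rewrite -setI_eq0 -subset0 -dK setIC setISS ?subsetDl //.
  move=> [K K'] [L L'] PK PL; case=> eqM eqpt eqD eqpt'.
  have [eqK eqK'] := decode K K' PK; have [eqL eqL'] := decode L L' PL.
  congr pair; first by rewrite eqK eqL eqD eqpt.
  by rewrite eqK' eqL' eqM eqpt eqpt'.
rewrite -(card_in_imset code_inj); apply: leq_trans (subset_leq_card code_sub) _.
rewrite !cardsX; apply: leq_mul le_MP _.
have {2}-> : k - t = (k - t - (t - 1)) + (t - 1) by lia.
by rewrite expnD leq_mul // card_ksubsets bin_leqX.
Qed.

(** Relative to a fixed full [K0], the three terms count the nonfull sets, the sets meeting [K0],
    and the disjoint full sets with other petals. *)
Definition petals_const :=
  nonfull_const + (k - t) + 2 * (2 ^ (k - t) * (k - t)`!) * (nonfull_const * 2 ^ (k - t)).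

Lemma common_petals :
    2 * (k - t) <= #|X| -> 2 * (2 ^ (k - t) * (k - t)`!) * nonfull_const <= #|X| ->
  exists TT : {set {set X}}, [/\ TT \subset ksubsets X t, sunflower_free s TT, #|TT| = phi
    & #|[set K in ksubsets X (k - t) | petals K != TT]| <= petals_const * #|X| ^ (k - t - 1)].
Proof.
set a := k - t; set f := 2 ^ a * a`! => leX leX2.
have a_gt0 : 0 < a by rewrite /a; lia.
have X_gt0 : 0 < #|X| by lia.
have le_non := card_nonfull; rewrite -/a in le_non.
have XE : #|X| ^ a = #|X| * #|X| ^ (a - 1) by rewrite -expnS; congr (_ ^ _); lia.
have leXfull : #|X| ^ a <= 2 * f * #|full|.
  have le_bin : #|X| ^ a <= f * 'C(#|X|, a) by apply: leqX_bin; lia.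
  have : 2 * f * #|nonfull| <= #|X| ^ a.
    apply: leq_trans (_ : 2 * f * (nonfull_const * #|X| ^ (a - 1)) <= _).
      by rewrite leq_mul2l le_non orbT.
    by rewrite mulnA XE leq_mul2r leX2 orbT.
  have : 2 * #|X| ^ a <= 2 * f * #|full| + 2 * f * #|nonfull|.
    by rewrite -mulnDr card_full -mulnA leq_mul2l le_bin orbT.
  by move: (#|X| ^ a) (2 * f * #|full|) (2 * f * #|nonfull|) => *; lia.
have [K1 fullK1] : exists K, K \in full.
  apply/card_gt0P; have : 0 < 2 * f * #|full|.
    by apply: leq_trans leXfull; rewrite expn_gt0 X_gt0.
  by rewrite muln_gt0 => /andP[].
pose deg K := #|[set K' in full | [disjoint K & K'] && (petals K != petals K')]|.
(* The full set with the fewest disjoint full sets of different petals does at least as well as the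
   average given by [card_different_pairs]. *)
case: (arg_minnP deg fullK1) => K0 fullK0 minK0.
have le_deg : deg K0 <= 2 * f * (#|nonfull| * 2 ^ a).
  have le_pairs : #|full| * deg K0 <= #|nonfull| * 2 ^ a * #|X| ^ a.
    apply: leq_trans card_different_pairs; rewrite -sum_nat_const.
    apply: leq_trans (_ : \sum_(K in full) deg K <= _).
      by apply: leq_sum => K; apply: minK0.
    rewrite /deg; under eq_bigr => K _ do rewrite -sum1_card.
    rewrite pair_big_dep /= -sum1_card; apply/eq_leq/eq_bigl => [[K K']].
    by rewrite !inE /= !andbA.
  have : deg K0 * #|X| ^ a <= 2 * f * (#|nonfull| * 2 ^ a) * #|X| ^ a.
    apply: leq_trans (_ : deg K0 * (2 * f * #|full|) <= _).
      by rewrite leq_mul2l leXfull orbT.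
    by rewrite mulnCA -[leqRHS]mulnA leq_mul2l [deg K0 * _]mulnC le_pairs orbT.
  by rewrite leq_pmul2r // expn_gt0 X_gt0.
have /setIdP[K0a /eqP cardK0] := fullK0; rewrite inE -/a in K0a.
exists (petals K0); split=> //; first exact: petals_ksubsets.
  rewrite -[petals K0]setUid; apply: petals_free.
  by rewrite setIid (eqP K0a) /a; lia.
apply: leq_trans (_ : #|nonfull :|: ([set K in ksubsets X a | ~~ [disjoint K & K0]]
   :|: [set K' in full | [disjoint K0 & K'] && (petals K0 != petals K')])| <= _).
  apply/subset_leq_card/subsetP=> K /[!inE]/andP[-> neK] /=.
  rewrite [petals K0 == _]eq_sym neK.
  by rewrite [[disjoint K & K0]]disjoint_sym; case: (_ == _); case: [disjoint _ & _].
have le_meet := card_meeting a K0; rewrite (eqP K0a) in le_meet.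
have le_deg2 : deg K0 <= 2 * f * (nonfull_const * 2 ^ a) * #|X| ^ (a - 1).
  apply: leq_trans le_deg _; rewrite -[leqRHS]mulnA leq_mul2l mulnAC leq_mul2r le_non.
  by rewrite !orbT.
rewrite /petals_const -/a -/f [leqRHS]mulnDl [X in _ <= X + _]mulnDl -addnA.
apply: leq_trans (leq_card_setU _ _).1 (leq_add le_non _).
exact: leq_trans (leq_card_setU _ _).1 (leq_add le_meet le_deg2).
Qed.

(** A frame member outside [F] splits into its trace in [TT] and a rest [K] whose petals differ from
    [TT]; otherwise the trace would be a petal of [K] and the member would lie in [F]. *)
Lemma common_frame :
    2 * (k - t) <= #|X| -> 2 * (2 ^ (k - t) * (k - t)`!) * nonfull_const <= #|X| ->
  exists TT : {set {set X}}, [/\ TT \subset ksubsets X t, sunflower_free s TT, #|TT| = phi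
    & #|frame k TT :\: F| <= phi * petals_const * #|X| ^ (k - t - 1)].
Proof.
move=> leX leX2; have [TT [TTt freeT cardT le_K]] := common_petals leX leX2.
exists TT; split=> //; rewrite -mulnA -{1}cardT.
apply: leq_trans (leq_mul (leqnn #|TT|) le_K); rewrite -cardsX.
rewrite -(@card_in_imset _ _ (fun A => (A :&: cover TT, A :\: cover TT))).
  apply/subset_leq_card/subsetP=> _ /imsetP[A /setDP[/setIdP[Ak TA] notFA] ->].
  rewrite inE TA /=; rewrite !inE in Ak *.
  rewrite -{1}(setID A (cover TT)) cardsU (ksubsetsP _ _ TTt _ TA) in Ak.
  have disj : [disjoint A :&: cover TT & A :\: cover TT].
    by rewrite disjoint_sym disjoints_subset (subset_trans (subsetDr _ _)) // setCS subsetIr.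
  rewrite disjoint_setI0 // cards0 in Ak; apply/andP; split; first by apply/eqP; lia.
  apply: contra notFA => /eqP eqT; have : A :&: cover TT \in petals (A :\: cover TT).
    by rewrite eqT.
  by case/setIdP=> _ /andP[]; rewrite setID.
by move=> A B _ _ [eqI eqD]; rewrite -(setID A (cover TT)) eqI eqD setID.
Qed.

End CommonFrame.

(** * Stability *)

(** Such a set splits into [m] disjoint [j]-sets from [B] and [r] further points. *)
Lemma card_all_subsets_in (X : finType) (B : {set {set X}}) j m r :
  #|[set E in ksubsets X (j * m + r) |
      [forall D : {set X}, (D \subset E) && (#|D| == j) ==> (D \in B)]]|
    <= #|B| ^ m * #|X| ^ r.
Proof.
elim: m => [|m IH].
  rewrite muln0 add0n expn0 mul1n; apply: leq_trans (bin_leqX _ _).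
  by rewrite -card_ksubsets subset_leq_card // setIdE subsetIl.
rewrite expnS -mulnA; apply: leq_trans (leq_mul (leqnn _) IH).
rewrite -cardsX; apply: leq_trans (leq_imset_card (fun p => p.1 :|: p.2) _).
apply/subset_leq_card/subsetP=> E /setIdP[]; rewrite inE => /eqP cardE /forallP allE.
have [|D sDE cardD] := @subset_of_card X E j; first by rewrite cardE mulnS -addnA leq_addr.
apply/imsetP; exists (D, E :\: D); last first.
  by rewrite /=; have := setID E D; rewrite (setIidPr sDE).
rewrite !inE /=; apply/and3P; split.
- by have := allE D; rewrite sDE cardD eqxx.
- by rewrite cardsD (setIidPr sDE) cardD cardE mulnS -addnA addKn.
apply/forallP=> D'; apply/implyP=> /andP[sD' cardD'].
by have := allE D'; rewrite cardD' (subset_trans sD') ?subsetDl.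
Qed.

Section Stability.
Variables (X : finType) (s t k q y c : nat) (F TT : {set {set X}}).
Implicit Types (A B C D E K T : {set X}).
Hypotheses (s_gt1 : 1 < s) (t_gt0 : 0 < t) (lt_tk : 2 * t < k) (le_ttk : 2 * t * (t - 1) <= k).
Hypothesis le_q : 2 * k * s <= q.
Hypotheses (Fk : F \subset ksubsets X k) (freeF : sunflower_core_free s (t - 1) F).
Hypothesis maxF : forall G : {set {set X}}, G \subset ksubsets X k ->
  sunflower_core_free s (t - 1) G -> #|G| <= #|F|.
Hypotheses (TTt : TT \subset ksubsets X t) (freeT : sunflower_free s TT).
Hypothesis maxT : forall G : {set {set X}}, G \subset ksubsets X t ->
  sunflower_free s G -> #|G| <= #|TT|.
Hypothesis le_y : #|cover TT| <= y.
Local Notation Y := (cover TT).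
Local Notation N := #|X|.
Local Notation M := (frame k TT :\: F).
Hypothesis le_M : #|M| <= c * N ^ (k - t - 1).
Hypothesis le_X : 2 * (y + q + k) <= N.

Let X_gt0 : 0 < N. Proof. by lia. Qed.
Let lt_t1k : t - 1 < k. Proof. by lia. Qed.

Lemma petal_sub_cover T : T \in TT -> T \subset Y.
Proof. exact: bigcup_sup. Qed.

Definition bad_cores j := [set D in ksubsets X j |
  [disjoint D & Y] && [exists T in TT, ~~ kernel q F (T :|: D)]].

(** One factor [2 ^ k] bounds the bad sets inside a single missing member; the rest comes from
    comparing a power with a binomial coefficient. *)
Definition missing_const := 2 ^ k * (2 ^ k * k`!).

(** Let [B] refute that [T :|: D] is a kernel. Adding to [T :|: D] any points outside [Y], [B] and
    [D] gives a frame member that is not in [F]. *)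
Lemma card_bad_cores j : j < t ->
  #|bad_cores j| * N ^ (k - t - j) <= missing_const * #|M|.
Proof.
move=> lt_jt; set b := 'C(N - (y + q + j), k - t - j).
have le_b : N ^ (k - t - j) <= 2 ^ k * k`! * b.
  apply: leq_trans (_ : 2 ^ (k - t - j) * (k - t - j)`! * b <= _).
    by apply: leqX_bin; lia.
  by rewrite leq_mul2r leq_mul ?orbT // ?leq_pexp2l ?leq_fact //; lia.
have le_DM D : D \in bad_cores j -> b <= #|[set A in M | D \subset A]|.
  case/setIdP=> /[!inE] /eqP cardD /andP[dDY /exists_inP[T TT_T]].
  rewrite negb_forall => /existsP[B]; rewrite negb_imply => /andP[leB noA].
  pose Z := ~: (Y :|: B :|: D).
  have leZ : N - (y + q + j) <= #|Z|.
    rewrite [#|Z|]cardsCs setCK; have := (leq_card_setU (Y :|: B) D).1.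
    by have := (leq_card_setU Y B).1; lia.
  apply: leq_trans (leq_bin2l _ leZ) _; rewrite -cards_draws.
  have dZ x : x \in Z -> [/\ x \notin Y, x \notin B & x \notin D].
    by rewrite !inE !negb_or => /andP[/andP[]].
  have sTY := petal_sub_cover TT_T.
  have dT (R : {set X}) : R \subset Z -> T :&: (D :|: R) = set0.
    move=> /subsetP sRZ; apply/setP=> x; rewrite !inE; apply/negP=> /andP[Tx].
    have Yx := subsetP sTY x Tx; case/orP=> [Dx|/sRZ/dZ[]]; last by rewrite Yx.
    by have := disjointFr dDY Dx; rewrite Yx.
  rewrite -(@card_in_imset _ _ (fun R : {set X} => T :|: (D :|: R))).
    apply/subset_leq_card/subsetP=> _ /imsetP[R /setIdP[sRZ /eqP cardR] ->].
    have dDR : D :&: R = set0.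
      apply/setP=> x; rewrite !inE; apply/negP=> /andP[Dx /(subsetP sRZ)/dZ[_ _]].
      by rewrite Dx.
    have meetY : (T :|: (D :|: R)) :&: Y = T.
      rewrite setIUl (setIidPl sTY); apply/setUidPl/subsetP=> x /setIP[/setUP[Dx|Rx] Yx].
        by have := disjointFr dDY Dx; rewrite Yx.
      by have [] := dZ x (subsetP sRZ x Rx); rewrite Yx.
    rewrite inE [in X in _ && X]setUCA subsetUl andbT inE [X in _ && X]inE meetY TT_T andbT.
    rewrite inE !cardsU dT // dDR !cards0 !subn0 cardD cardR (ksubsetsP _ _ TTt _ TT_T).
    apply/andP; split; last by apply/eqP; lia.
    apply/negP=> FA; move: noA; rewrite negb_exists_in => /forall_inP/(_ _ FA)/negP; apply.
    rewrite setUA subsetUl /=; apply/subsetP=> x /setIP[/setUP[//|Rx] Bx].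
    by have [_] := dZ x (subsetP sRZ x Rx); rewrite Bx.
  move=> R R' /setIdP[sRZ _] /setIdP[sRZ' _] /= eqU.
  have meetZ (Q : {set X}) : Q \subset Z -> (T :|: (D :|: Q)) :&: Z = Q.
    move=> sQZ; apply/setP=> x; rewrite !in_setI !in_setU; apply/andP/idP => [[+ Zx]|Qx].
      have [Y'x _ D'x] := dZ x Zx; case/or3P=> [Tx|Dx|//].
        by rewrite (subsetP sTY x Tx) in Y'x.
      by rewrite Dx in D'x.
    by rewrite Qx !orbT (subsetP sQZ).
  by rewrite -(meetZ R) // eqU meetZ.
have dbl : #|bad_cores j| * b <= 2 ^ k * #|M|.
  rewrite -sum_nat_const.
  apply: leq_trans (_ : \sum_(D in bad_cores j) #|[set A in M | D \subset A]| <= _).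
    exact: leq_sum.
  under eq_bigr => D _ do rewrite -sum1_card.
  rewrite (exchange_big_dep (fun A => A \in M)) => [|D A _ /setIdP[] //].
  rewrite mulnC -sum_nat_const; apply: leq_sum => A MA.
  have cardA : #|A| = k by case/setDP: MA => /setIdP[/[!inE]/eqP].
  rewrite sum1_card -cardA -card_powerset; apply/subset_leq_card/subsetP=> D.
  by rewrite unfold_in => /andP[_ /setIdP[_ sDA]]; rewrite inE.
apply: leq_trans (leq_mul (leqnn _) le_b) _.
by rewrite mulnCA /missing_const -[leqRHS]mulnA [leqRHS]mulnCA leq_mul2l dbl orbT.
Qed.

Definition bad_const := missing_const * c.

(** The factor [N] stays on the left so that the bound is also meaningful for [j = 0], where it
    excludes bad sets once [N] is large. *)
Lemma card_bad_coresX j : j < t -> #|bad_cores j| * N <= bad_const * N ^ j.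
Proof.
move=> lt_jt; have := leq_trans (card_bad_cores lt_jt) (leq_mul (leqnn _) le_M).
have -> : N ^ (k - t - 1) = N ^ (k - t - j - 1) * N ^ j by rewrite -expnD; congr (_ ^ _); lia.
have -> : N ^ (k - t - j) = N ^ (k - t - j - 1) * N.
  by rewrite -expnSr; congr (_ ^ _); lia.
move=> le_bN; rewrite -(@leq_pmul2l (N ^ (k - t - j - 1))) ?expn_gt0 ?X_gt0 //.
by rewrite [leqRHS]mulnCA mulnCA /bad_const -[leqRHS]mulnA.
Qed.


(** * Members obstructing the completion of the frame *)

Definition viol_shape z j := [set E in ksubsets X k | (#|E :&: Y| == z) &&
  [forall D : {set X}, (D \subset E :\: Y) && (#|D| == j) ==> (D \in bad_cores j)]].

Definition viol_const := 2 ^ y * (bad_const.+1 ^ k.+1 * missing_const).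

Lemma viol_shape0 z : bad_const < N -> viol_shape z 0 = set0.
Proof.
move=> ltX; apply/eqP/set0Pn=> -[E /setIdP[_ /andP[_ /forallP/(_ set0)]]].
rewrite sub0set cards0 eqxx /= => bad0.
have := card_bad_coresX t_gt0; rewrite expn0 muln1.
have : 0 < #|bad_cores 0| by apply/card_gt0P; exists set0.
move: ltX; case: #|bad_cores 0| => // b lt _; rewrite mulSn; lia.
Qed.

(* The count (b ^ m) N ^ r of the sets whose j-subsets are all bad is compared with
   b N ^ (k - t - j), where b = #|bad_cores j| = O(N ^ (j - 1)).  This needs m >= t - z + 2,
   hence k - z >= j * (t - z + 2). *)
Lemma card_viol_shape z j : z <= t -> 0 < j -> j < t ->
  #|viol_shape z j| * N <= viol_const * #|M|.
Proof.
move=> le_zt j_gt0 lt_jt; pose w := t - z; pose r := k - z - j * w.+2.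
set b := #|bad_cores j|.
(* The extreme case is [j = t - 1] and [z = 0], where [(t - 1) * (t + 2) <= 2 * t * (t - 1)] because
   [0 < j < t] forces [t >= 2]. *)
have le_jk : j * w.+2 <= k - z.
  apply: leq_trans (_ : (t - 1) * w.+2 <= _); first by rewrite leq_mul2r; lia.
  have [t' eqt] : exists t', t = t'.+2 by exists (t - 2); lia.
  have [v eqv] : exists v, t = w + v by exists z; rewrite /w; lia.
  have -> : z = v by rewrite /w in eqv; lia.
  move: le_ttk; have -> : t - 1 = t'.+1 by lia.
  have : w <= t'.+2 by lia.
  clearbody w; rewrite eqt in eqv *; clear -eqv => lew lek.
  suff : t'.+1 * w.+2 + v <= k by lia.
  by nia.
have kzE : k - z = j * w.+2 + r by rewrite /r; lia.
have le_shape : #|viol_shape z j| <= 2 ^ y * (b ^ w.+2 * N ^ r).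
  apply: leq_trans (_ : #|powerset Y| * (b ^ w.+2 * N ^ r) <= _); last first.
    by rewrite leq_mul2r card_powerset leq_pexp2l ?orbT.
  apply: leq_trans (leq_mul (leqnn _) (card_all_subsets_in (bad_cores j) j w.+2 r)).
  rewrite -cardsX -(@card_in_imset _ _ (fun E => (E :&: Y, E :\: Y))).
    apply/subset_leq_card/subsetP=> _ /imsetP[E /setIdP[Ek /andP[/eqP cardEY allE]] ->].
    rewrite !inE subsetIr /= allE andbT -kzE -cardEY.
    by rewrite cardsD; move: Ek; rewrite inE => /eqP->.
  by move=> E E' _ _ [eqI eqD]; rewrite -(setID E Y) eqI eqD setID.
have le_bw : b ^ w.+2 * N ^ r * N <= bad_const.+1 ^ k.+1 * (b * N ^ (k - t - j)).
  rewrite -(@leq_pmul2r (N ^ w)) ?expn_gt0 ?X_gt0 //.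
  have -> : b ^ w.+2 * N ^ r * N * N ^ w = b * ((b * N) ^ w.+1 * N ^ r).
    by rewrite expnMn [b ^ _.+2]expnS [N ^ w.+1]expnS; ring.
  have -> : bad_const.+1 ^ k.+1 * (b * N ^ (k - t - j)) * N ^ w =
     b * (bad_const.+1 ^ k.+1 * (N ^ j) ^ w.+1 * N ^ r).
    have -> : (N ^ j) ^ w.+1 = N ^ (j * w.+1) by rewrite expnM.
    have -> : b * (bad_const.+1 ^ k.+1 * N ^ (j * w.+1) * N ^ r)
      = bad_const.+1 ^ k.+1 * (b * N ^ (j * w.+1 + r)) by rewrite expnD; ring.
    rewrite -!mulnA -expnD; congr (_ * (_ * N ^ _)).
    by move: kzE; rewrite mulnS /w; lia.
  rewrite leq_mul2l leq_mul2r; apply/orP; right; apply/orP; right.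
  apply: leq_trans (_ : (bad_const.+1 * N ^ j) ^ w.+1 <= _).
    rewrite leq_exp2r //; apply: leq_trans (card_bad_coresX lt_jt) _.
    by rewrite leq_mul2r leqnSn orbT.
  by rewrite expnMn leq_mul2r leq_pexp2l ?orbT // /w; lia.
apply: leq_trans (leq_mul le_shape (leqnn N)) _.
rewrite /viol_const -!(mulnA (2 ^ y)) leq_mul2l; apply/orP; right.
apply: leq_trans le_bw _; rewrite -[leqRHS]mulnA leq_mul2l.
by rewrite card_bad_cores ?orbT.
Qed.

Definition violators :=
  [set E in F | (#|E :&: Y| <= t) && [forall T in TT, ~~ (T \subset E)]].

(* If a violator E had no such shape, then adding to TT the set E :&: Y, completed
   to size t inside E, would not create a sunflower. *)
Lemma violators_shape E : E \in violators ->
  [exists z : 'I_t.+1, [exists j : 'I_t, E \in viol_shape z j]].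
Proof.
case/setIdP=> FE /andP[le_Zt /forall_inP notE].
have cardE : #|E| = k := ksubsetsP _ _ Fk E FE.
set Z := E :&: Y in le_Zt *; apply: contraT => noshape.
have cardEY : #|E :\: Y| = k - #|Z| by rewrite cardsD cardE.
have [|D sDE cardD] := @subset_of_card X (E :\: Y) (t - #|Z|); first by rewrite cardEY; lia.
have dDY : D :&: Y = set0.
  apply/eqP; rewrite setI_eq0 disjoints_subset; apply: subset_trans sDE _.
  by rewrite setDE subsetIr.
pose Z' := Z :|: D.
have cardZ' : #|Z'| = t.
  rewrite cardsU cardD; have -> : Z :&: D = set0.
    by apply/eqP; rewrite -subset0 -dDY [D :&: Y]setIC setSI ?subsetIr.
  by rewrite cards0; lia.
have sZE : Z' \subset E by rewrite subUset subsetIl (subset_trans sDE) ?subsetDl.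
have TZ' : Z' \notin TT by apply/negP=> /notE; rewrite sZE.
have UTt : Z' |: TT \subset ksubsets X t by rewrite subUset TTt andbT sub1set inE cardZ'.
suff : #|Z' |: TT| <= #|TT| by rewrite cardsU1 TZ' add1n ltnn.
apply: maxT => // S sS sunS; have [cardS meetS] := sunS.
have lt_core : #|core S| < t.
  by apply: (sunflower_core_lt s_gt1 sunS) => T /(subsetP sS); apply: ksubsetsP.
have inTT T : T \in S -> T != Z' -> T \in TT.
  by move=> /(subsetP sS)/setU1P[->|//]; rewrite eqxx.
have [Z'S|notZ'S] := boolP (Z' \in S); last first.
  apply: (freeT _ sunS); apply/subsetP=> T ST; apply: inTT => //.
  by apply: contraNneq notZ'S => <-.
have meetE T : T \in S -> T != Z' -> T :&: E = core S.
  move=> ST neT; have sTY := petal_sub_cover (inTT T ST neT).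
  rewrite -(meetS T Z') // /Z' setIUr [T :&: D]setIC.
  have -> : D :&: T = set0 by apply/eqP; rewrite -subset0 -dDY setIS.
  by rewrite setU0 /Z setIA setIAC (setIidPl sTY).
(* This is the number of points that the core of [S] lacks to reach size [t - 1]. *)
pose j := t - 1 - #|core S|; have lt_jt : j < t by rewrite /j -subnDA ltn_subrL t_gt0.
case/negP: noshape; apply/existsP; exists (Ordinal (le_Zt : #|Z| < t.+1)).
apply/existsP; exists (Ordinal lt_jt); rewrite !inE cardE eqxx eqxx /=.
apply/forallP=> D'; apply/implyP=> /andP[sD' /eqP cardD'].
have dD'Y : D' :&: Y = set0.
  apply/eqP; rewrite setI_eq0 disjoints_subset; apply: subset_trans sD' _.
  by rewrite setDE subsetIr.
have sD'E : D' \subset E by apply: subset_trans sD' (subsetDl _ _).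
rewrite !inE cardD' eqxx -setI_eq0 dD'Y eqxx /=; apply: contraT.
rewrite negb_exists_in => /forall_inP kerT.
have dTD' T : T \in S -> T != Z' -> T :&: D' = set0.
  move=> ST neT; apply/eqP; rewrite -subset0 -dD'Y setIC setIS //.
  exact: petal_sub_cover (inTT T ST neT).
have cardC : #|core S :|: D'| = t - 1.
  have [T ST neT] : exists2 T, T \in S & T != Z'.
    have : 0 < #|S :\ Z'| by move: s_gt1; rewrite -cardS (cardsD1 Z') Z'S.
    by case/card_gt0P=> T /setD1P[]; exists T.
  rewrite cardsU cardD'; have -> : core S :&: D' = set0.
    by apply/eqP; rewrite -subset0 -(dTD' T ST neT) setSI ?core_sub.
  by rewrite cards0 subn0 /j subnKC // subn1 -ltnS prednK.
(* If [D'] were not bad, the kernels [T :|: D'], with the member [E] itself in place of [Z'], would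
   extend to a sunflower of [F] with core of size [t - 1]. *)
have [|||R sRF [sunR coreR]] := @kernel_sunflower X _ S
    (fun T => if T == Z' then E else T :|: D') s k q F (core S :|: D') s_gt1 Fk _ cardS le_q.
- by rewrite cardC.
- move=> T ST; case: eqP => [_|/eqP neT]; first exact: kernel_mem.
  by rewrite -[kernel _ _ _]negbK kerT ?inTT.
- have meetE' T : T \in S -> T != Z' -> (T :|: D') :&: E = core S :|: D'.
    by move=> ST neT; rewrite setIUl meetE // (setIidPl sD'E).
  move=> T T' ST ST' neTT'; case: (altP (T =P Z')) => [eqT|neT];
    case: (altP (T' =P Z')) => [eqT'|neT'].
  + by rewrite eqT eqT' eqxx in neTT'.
  + by rewrite setIC meetE'.
  + by rewrite meetE'.
  + by rewrite -setUIl meetS.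
by case: (freeF sRF sunR); rewrite coreR.
Qed.

Definition obstructors := [set E in F | (t < #|E :&: Y|) &&
  [exists D : {set X}, [&& #|D| < t, D \in bad_cores #|D| & D \subset E]]].

(** The family compared with [F] by maximality. *)
Definition completed := frame k TT :|:
  [set E in F | (t < #|E :&: Y|) && (E \notin obstructors)].

(** A forbidden sunflower must use some [E] outside the frame, and [D], the part of the core outside
    [Y], is not bad because [E] is no obstructor. Frame members, possibly missing from [F], can then
    be replaced by the kernels [(A :&: Y) :|: D] without changing pairwise intersections, which
    yields a forbidden sunflower in [F]. *)
Lemma completed_core_free : sunflower_core_free s (t - 1) completed.
Proof.
move=> S sS sunS coreS; have [cardS meetS] := sunS.
have [sSf|/subsetPn[E SE notfE]] := boolP (S \subset frame k TT).
  exact: (frame_core_free s_gt1 t_gt0 TTt freeT sSf sunS coreS).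
have := subsetP sS E SE; rewrite inE (negPf notfE) /= => /setIdP[FE /andP[ltEY obsE]].
pose D := core S :\: Y.
have sDE : D \subset E := subset_trans (subsetDl _ _) (core_sub SE).
have cardD : #|D| < t.
  by apply: leq_ltn_trans (subset_leq_card (subsetDl _ _)) _; rewrite coreS subn1 prednK.
have goodD T : T \in TT -> kernel q F (T :|: D).
  move=> TT_T; apply: contraR obsE => nker; rewrite inE FE ltEY /=.
  apply/existsP; exists D; rewrite cardD sDE andbT !inE eqxx /=; apply/andP; split.
    by rewrite disjoints_subset /D setDE subsetIr.
  by apply/exists_inP; exists T.
pose g A := if A \in frame k TT then (A :&: Y) :|: D else A.
have gP A : A \in S -> core S \subset g A /\ g A \subset A.
  move=> SA; have sCA := core_sub SA; rewrite /g; case: ifP => // _; split.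
    rewrite -{1}(setID (core S) Y) subUset (subset_trans _ (subsetUl _ _)) ?setSI //.
    exact: subsetUr.
  by rewrite subUset subsetIl (subset_trans (subsetDl _ _)).
have [|||R sRF [sunR coreR]] :=
    @kernel_sunflower X _ S g s k q F (core S) s_gt1 Fk _ cardS le_q.
- by rewrite coreS.
- move=> A SA; rewrite /g; case: ifP => [/setIdP[_ /goodD]//|notfA].
  have := subsetP sS A SA; rewrite inE notfA /= => /setIdP[FA _].
  exact: kernel_mem.
- move=> A B SA SB neAB; apply/eqP; rewrite eqEsubset.
  have [sCA sgA] := gP A SA; have [sCB sgB] := gP B SB.
  by rewrite -{1}(meetS A B) // setISS //= subsetI sCA.
by apply: (freeF sRF sunR); rewrite coreR.
Qed.

(** Completion adds [M] and removes only violators and obstructors: a member with at most [t] points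
    in [Y] that contains some [T] in [TT] has trace [T] and lies in the frame. *)
Lemma leq_missing : #|M| <= #|violators| + #|obstructors|.
Proof.
have le_completed : #|completed| <= #|F|.
  apply: maxF; last exact: completed_core_free.
  rewrite subUset /frame setIdE subsetIl; apply: subset_trans Fk.
  by rewrite setIdE subsetIl.
have sMC : M \subset completed by apply: subset_trans (subsetDl _ _) (subsetUl _ _).
have sF : F \subset (completed :\: M) :|: (violators :|: obstructors).
  apply/subsetP=> E FE.
  rewrite !in_setU in_setD [E \in completed]in_setU [E \in M]in_setD FE /=.
  have [//|notfE] := boolP (E \in frame k TT); rewrite /=.
  have [ltEY|leEY] := boolP (t < #|E :&: Y|).
    rewrite [E \in [set _ in _ | _]]inE FE ltEY /=.
    by case: (E \in obstructors); rewrite // !orbT.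
  rewrite -leqNgt in leEY; rewrite [E \in violators]inE FE leEY /=.
  suff -> : [forall T in TT, ~~ (T \subset E)] by rewrite orbT.
  apply/forall_inP=> T TT_T; apply: contra notfE => sTE.
  have eqT : T = E :&: Y.
    apply/eqP; rewrite eqEcard subsetI sTE petal_sub_cover //=.
    by rewrite (ksubsetsP _ _ TTt T TT_T).
  by rewrite inE -eqT TT_T andbT inE (ksubsetsP _ _ Fk).
have cardCM : #|completed| = #|M| + #|completed :\: M|.
  by rewrite -(cardsID M completed) (setIidPr sMC).
have := leq_trans (subset_leq_card sF) (leq_card_setU _ _).1.
have := (leq_card_setU violators obstructors).1.
move: le_completed cardCM.
move: #|completed| #|M| #|completed :\: M| #|F| #|violators| #|obstructors| => *.
lia.
Qed.

Lemma card_violators : bad_const < N -> #|violators| * N <= t.+1 * (t * viol_const) * #|M|.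
Proof.
move=> ltX.
have sub : violators \subset
    \bigcup_(z in [set: 'I_t.+1]) \bigcup_(j in [set: 'I_t]) viol_shape z j.
  apply/subsetP=> E /violators_shape /existsP[z /existsP[j Ezj]].
  by apply/bigcupP; exists z => //; apply/bigcupP; exists j.
(* The integer quotient turns the bounds carrying a factor [N] into bounds on cardinalities, which
   can be summed over all shapes. *)
pose v := viol_const * #|M| %/ N.
have le_v (z : 'I_t.+1) (j : 'I_t) : #|viol_shape z j| <= v.
  rewrite leq_divRL //; case: j => [[|j] ltj] /=; first by rewrite viol_shape0 // cards0.
  by apply: card_viol_shape => //; rewrite -ltnS.
apply: leq_trans (_ : t.+1 * (t * v) * N <= _).
  rewrite leq_mul2r; apply/orP; right; apply: leq_trans (subset_leq_card sub) _.
  apply: leq_trans (leq_card_bigcup (c := t * v) _) _; last by rewrite cardsT card_ord.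
  move=> z _; apply: leq_trans (leq_card_bigcup (c := v) _) _ => //.
  by rewrite cardsT card_ord.
rewrite -!(mulnA t.+1) leq_mul2l -!(mulnA t) leq_mul2l; apply/orP; right.
by apply/orP; right; apply: leq_divM.
Qed.

(** An obstructor is covered by [t + 1] points of [Y], a bad [D] and the remaining points. The extra
    point in [Y] saves one factor [N] against [card_bad_cores]. *)
Lemma card_obstructors : #|obstructors| * N <= t * (2 ^ y * missing_const) * #|M|.
Proof.
pose O (j : 'I_t) := [set E in F | (t < #|E :&: Y|) &&
  [exists D in bad_cores j, D \subset E]].
have sub : obstructors \subset \bigcup_(j in [set: 'I_t]) O j.
  apply/subsetP=> E /setIdP[FE /andP[ltEY /existsP[D /and3P[cardD badD sDE]]]].
  apply/bigcupP; exists (Ordinal cardD); rewrite // inE FE ltEY /=.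
  by apply/exists_inP; exists D.
have le_O (j : 'I_t) : #|O j| * N <= 2 ^ y * missing_const * #|M|.
  apply: leq_trans (_ : 2 ^ y * (#|bad_cores j| * N ^ (k - t.+1 - j)) * N <= _); last first.
    rewrite -!(mulnA (2 ^ y)) leq_mul2l -(mulnA #|bad_cores j|) -expnSr; apply/orP; right.
    apply: leq_trans (card_bad_cores (ltn_ord j)).
    rewrite leq_mul2l; apply/orP; right; rewrite leq_pexp2l //.
    by have := ltn_ord j; lia.
  rewrite leq_mul2r; apply/orP; right.
  apply: leq_trans (_ : #|setX (powerset Y) (setX (bad_cores j)
                          (ksubsets X (k - t.+1 - j)))| <= _).
    apply: leq_trans (leq_imset_card (fun p => p.1 :|: (p.2.1 :|: p.2.2)) _).
    apply/subset_leq_card/subsetP=> E /setIdP[FE /andP[ltEY /exists_inP[D badD sDE]]].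
    have [W sW cardW] := subset_of_card ltEY.
    have [sWE sWY] : W \subset E /\ W \subset Y by apply/andP; rewrite -subsetI.
    have /setIdP[/[!inE] /eqP cardD /andP[dDY _]] := badD.
    have sWDE : W :|: D \subset E by rewrite subUset sWE.
    apply/imsetP; exists (W, (D, E :\: (W :|: D))); last first.
      by have := setID E (W :|: D); rewrite (setIidPr sWDE) /= setUA.
    rewrite !in_setX /= inE sWY badD inE cardsD (setIidPr sWDE) (ksubsetsP _ _ Fk E FE).
    rewrite cardsU cardW cardD; have -> : W :&: D = set0.
      apply/eqP; rewrite -subset0 setIC; move: dDY; rewrite -setI_eq0 => /eqP <-.
      exact: setIS.
    by rewrite cards0 /=; apply/eqP; lia.
  rewrite !cardsX card_powerset; apply: leq_mul; first by rewrite leq_pexp2l.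
  by rewrite leq_mul // card_ksubsets bin_leqX.
pose v := 2 ^ y * missing_const * #|M| %/ N.
apply: leq_trans (_ : t * v * N <= _).
  rewrite leq_mul2r; apply/orP; right; apply: leq_trans (subset_leq_card sub) _.
  apply: leq_trans (leq_card_bigcup (c := v) _) _; last by rewrite cardsT card_ord.
  by move=> j _; rewrite leq_divRL.
by rewrite -mulnA -[leqRHS]mulnA leq_mul2l leq_divM orbT.
Qed.

Definition stability_const :=
  bad_const + (t.+1 * (t * viol_const) + t * (2 ^ y * missing_const)).

(** The bounds combine to [#|M| * N] being at most a constant below [N] times [#|M|], so [M] is
    empty; the violators, bounded by a multiple of [#|M|], then vanish too. *)
Lemma frame_stability : stability_const < N ->
  frame k TT \subset F /\ forall E, E \in F ->
    (exists2 T, T \in TT & T \subset E) \/ t < #|E :&: Y|.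
Proof.
rewrite /stability_const => ltX; have ltX1 : bad_const < N by lia.
have le_viol := card_violators ltX1; have le_obs := card_obstructors.
have M0 : #|M| = 0.
  have : #|M| * N <= (t.+1 * (t * viol_const) + t * (2 ^ y * missing_const)) * #|M|.
    rewrite mulnDl; apply: leq_trans (leq_add le_viol le_obs).
    by rewrite -mulnDl leq_mul2r leq_missing orbT.
  case: #|M| => // m; rewrite mulnC leq_pmul2r // => leN.
  by move: ltX leN; move: (t.+1 * _ + _) => *; lia.
split; first by rewrite -setD_eq0 -cards_eq0 M0.
have viol0 : violators = set0.
  apply/eqP; rewrite -cards_eq0; move: le_viol; rewrite M0 muln0 leqn0 muln_eq0.
  by case/orP=> //; lia.
move=> E FE; have [ltEY|leEY] := ltnP t #|E :&: Y|; first by right.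
left; have : E \notin violators by rewrite viol0 inE.
rewrite inE FE leEY /= negb_forall_in => /exists_inP[T TT_T].
by rewrite negbK; exists T.
Qed.

End Stability.

(** * Decidable sunflower-freeness and choice of the threshold *)

Definition sunflower_freeb (X : finType) s (F : {set {set X}}) : bool :=
  [forall S : {set {set X}}, (S \subset F) ==>
    ~~ ((#|S| == s) && [forall A in S, [forall B in S, (A != B) ==> (A :&: B == core S)]])].

Lemma sunflower_freeP (X : finType) s (F : {set {set X}}) :
  reflect (sunflower_free s F) (sunflower_freeb s F).
Proof.
apply: (iffP forallP) => [freeF S sSF [cardS meetS]|freeF S].
  have := freeF S; rewrite sSF cardS eqxx /= => /negP; apply.
  apply/forall_inP=> A SA; apply/forall_inP=> B SB; apply/implyP=> neAB.
  by rewrite meetS.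
apply/implyP=> sSF; apply/negP=> /andP[/eqP cardS /forall_inP meetS].
apply: (freeF S sSF); split=> // A B SA SB neAB.
by have /forall_inP/(_ B SB) := meetS A SA; rewrite neAB => /eqP.
Qed.

(** The summands serve, in order, the two size conditions of [common_frame] and the two of
    [frame_stability], with [phi * t] bounding the support. *)
Definition threshold s k t phi :=
  let q := 2 * k * s in let a := k - t in
  2 * a + 2 * (2 ^ a * a`!) * nonfull_const t k q phi + 2 * (phi * t + q + k)
  + (stability_const t k (phi * t) (phi * petals_const t k q phi)).+1.

Theorem theorem1p4 (s k : nat) (hs : 2 <= s) :
  exists n0 : nat, forall t n : nat,
    1 <= t -> maxn (2 * t + 1) (2 * t * (t - 1)) <= k -> n0 <= n ->
    forall F : {set {set 'I_n}},
      extremal (fun G : {set {set 'I_n}} =>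
        G \subset ksubsets 'I_n k /\ sunflower_core_free s (t - 1) G) F ->
      exists T : {set {set 'I_n}},
        [/\ T \subset ksubsets 'I_n t,
            sunflower_free s T,
            is_phi s t #|T|,
            [set A in ksubsets 'I_n k | A :&: cover T \in T] \subset F
          & forall A : {set 'I_n}, A \in F ->
              (exists2 B : {set 'I_n}, B \in T & B \subset A) \/
              t + 1 <= #|A :&: cover T|].
Proof.
pose m := (2 * k * s) ^ k.
(* Here [m] is the Erdos-Rado bound, valid for every [t <= k]. The maxima remove the dependence on
   [t] and on the value of phi, and [(m * k).+1] leaves room to transfer any sunflower-free family
   of [t]-sets into ['I_n]. *)
exists ((m * k).+1 + \max_(t < k.+1) \max_(phi < m.+1) threshold s k t phi).
move=> t n t_gt0; rewrite geq_max => /andP[lt_tk le_ttk] le_n F [[Fk freeF] maxF].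
have {}lt_tk : 2 * t < k by rewrite -addn1.
have le_tk : t <= k by lia.
(* For [t <= 2] this follows from [2 * t < k]; for [t >= 3], from [2 * t * (t - 1) >= 4 * t]. *)
have le_3tk : 3 * t <= k.+1.
  move: t_gt0 lt_tk le_ttk; clear; case: t => [|[|[|t]]] //; rewrite ?subn1 /= => *; nia.
have bound_m (X : finType) (G : {set {set X}}) :
    G \subset ksubsets X t -> sunflower_free s G -> #|G| <= m.
  move=> Gt freeG; apply: leq_trans (sunflower_free_card hs t_gt0 Gt freeG) _.
  apply: leq_trans (_ : (2 * k * s) ^ t <= _).
    by rewrite leq_exp2r // leq_mul2r leq_mul2l le_tk !orbT.
  by rewrite leq_pexp2l // !muln_gt0; lia.
pose P (G : {set {set 'I_n}}) := (G \subset ksubsets 'I_n t) && sunflower_freeb s G.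
have P0 : P set0.
  rewrite /P sub0set; apply/sunflower_freeP => S; rewrite subset0 => /eqP-> [].
  by rewrite cards0; lia.
case: (arg_maxnP (fun G : {set {set 'I_n}} => #|G|) P0).
move=> T0 /andP[T0t /sunflower_freeP freeT0] maxT0.
pose phi := #|T0|.
have le_phi (G : {set {set 'I_n}}) :
    G \subset ksubsets 'I_n t -> sunflower_free s G -> #|G| <= phi.
  by move=> Gt /sunflower_freeP freeG; apply: maxT0; rewrite /P Gt.
have le_phim : phi <= m by apply: bound_m.
have le_thr : threshold s k t phi <= n.
  apply: leq_trans le_n; apply: leq_trans (leq_addl _ _).
  apply: leq_trans (leq_bigmax (Ordinal (le_tk : t < k.+1))).
  exact: leq_trans (leq_bigmax (Ordinal (le_phim : phi < m.+1))).
have maxF' (G : {set {set 'I_n}}) :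
  G \subset ksubsets 'I_n k -> sunflower_core_free s (t - 1) G -> #|G| <= #|F|.
  by move=> Gk freeG; apply: maxF.
rewrite /threshold in le_thr.
have [|||TT [TTt freeT cardT le_M]] := @common_frame 'I_n s t k (2 * k * s)
  phi F hs t_gt0 lt_tk le_3tk (leqnn _) Fk freeF maxF' le_phi.
- by exists T0.
- by rewrite card_ord; lia.
- by rewrite card_ord; lia.
have maxT (G : {set {set 'I_n}}) :
    G \subset ksubsets 'I_n t -> sunflower_free s G -> #|G| <= #|TT|.
  by rewrite cardT; apply: le_phi.
have le_y : #|cover TT| <= phi * t by have := leq_card_cover_ksubsets TTt; rewrite cardT.
have [||sF FP] := @frame_stability 'I_n s t k (2 * k * s) (phi * t)
  (phi * petals_const t k (2 * k * s) phi) F TT hs t_gt0 lt_tk le_ttk (leqnn _) Fk freeF maxF' TTt freeT maxT le_y le_M.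
- by rewrite card_ord; lia.
- by rewrite card_ord; lia.
exists TT; split=> //; last by move=> A /FP; rewrite addn1.
split; first by exists 'I_n, TT.
(* So far [phi] is only the maximum over families on ['I_n]; the transfer shows that no other ground
   set does better. *)
move=> X G Gt freeG.
have [||G' [G't freeG' <-]] := @sunflower_free_transfer X 'I_n s t G hs Gt freeG.
- by rewrite card_ord; lia.
- rewrite card_ord; apply: leq_trans (leq_card_cover_ksubsets Gt) _.
  apply: leq_trans (leq_mul (bound_m _ _ Gt freeG) le_tk) _.
  by lia.
exact: maxT.
Qed.
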